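(* Let $\Omega\subset\mathbb{R}^d$ be bounded, nonempty and open, $f\in L^2(\Omega)$, $\alpha\in L^\infty(\Omega)$, and let $\gamma:\mathbb{R}^d\times\mathbb{R}^d\to[0,\infty)$ be measurable (not necessarily symmetric) with $$\Big\|\frac12\int_\Omega|\gamma(\cdot,y)-\gamma(y,\cdot)|\,dy\Big\|_{L^\infty(\Omega)}+\Big\|\int_{\widehat\Gamma}|\gamma(\cdot,y)-\gamma(y,\cdot)|\,dy\Big\|_{L^\infty(\Omega)}<\infty.$$ Assume that there are constants $C>0$ and $c>0$ such that $\gamma(x,y)\le C\gamma(y,x)$ for a.e. $(y,x)\in\widehat\Gamma\times\Omega$ and such that for a.e. $x\in\Omega$ $$0<c<\alpha(x)+\frac12\int_\Omega\gamma(x,y)-\gamma(y,x)\,dy-\frac{C+1}{2}\int_{\widehat\Gamma}|\gamma(x,y)-\gamma(y,x)|\,dy.$$ Then the Neumann problem $$\mathcal{L}u(x)+\alpha(x)u(x)=f(x)\ \text{ for }x\in\Omega,\qquad \mathcal{N}u(y)=0\ \text{ for }y\in\widehat\Gamma,$$ has a weak solution; namely, there is a function $u\in\mathrm{V}(\Omega;\gamma)$ such that for all $v\in\mathrm{V}(\Omega;\gamma)$ $$\begin{aligned}&\frac12\int_\Omega\int_\Omega(u(x)\gamma(x,y)-u(y)\gamma(y,x))(v(x)-v(y))\,dy\,dx\\&+\int_\Omega\int_{\widehat\Gamma}(u(x)\gamma(x,y)-u(y)\gamma(y,x))(v(x)-v(y))\,dy\,dx+\int_\Omega u(x)v(x)\alpha(x)\,dx=\int_\Omega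 f(x)v(x)\,dx.\end{aligned}$$
   Context: Measurability is with respect to Lebesgue measure. Let $\Gamma:=\{y\in\mathbb{R}^d\setminus\Omega:\int_\Omega\gamma(y,x)\,dx>0\}$ and $\widehat\Gamma:=\{y\in\mathbb{R}^d\setminus\Omega:\int_\Omega\gamma(y,x)+\gamma(x,y)\,dx>0\}$. $\mathrm{V}(\Omega;\gamma)$ is the space of measurable $v:\mathbb{R}^d\to\mathbb{R}$ with $$\|v\|_{\mathrm{V}(\Omega;\gamma)}^2:=\int_\Omega v^2(x)\,dx+\int_\Omega\int_{\mathbb{R}^d}(v(x)-v(y))^2\gamma(y,x)\,dy\,dx<\infty,$$ functions agreeing a.e. on $\Omega\cup\Gamma$ being identified. Here $\mathcal{L}u(x)=\int_{\mathbb{R}^d}u(x)\gamma(x,y)-u(y)\gamma(y,x)\,dy$ and $\mathcal{N}u(y)=\int_\Omega u(y)\gamma(y,x)-u(x)\gamma(x,y)\,dx$. *)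

(* Defs.v *)
From HB Require Import structures.
From mathcomp Require Import all_boot all_order all_algebra.
From mathcomp Require Import all_classical all_reals all_analysis.
From mathcomp Require Import lra.

Set Implicit Arguments.
Unset Strict Implicit.
Unset Printing Implicit Defensive.

Import Order.TTheory GRing.Theory Num.Theory.
Import numFieldNormedType.Exports.

Local Open Scope classical_set_scope.
Local Open Scope ring_scope.

Section LebesgueMeasure.
Context (R : realType) (d : nat).
Local Notation box := ('rV[R]_d * 'rV[R]_d)%type.

Definition box_set (p : box) : set 'rV[R]_d :=
  [set x | forall i, p.1 ord0 i < x ord0 i <= p.2 ord0 i].

Definition box_vol (p : box) : R :=
  \prod_(i < d) Num.max 0 (p.2 ord0 i - p.1 ord0 i).

(* Covers are countable sets of boxes, rather than sequences of boxes: when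
   d = 0 no box is empty, and the empty set needs the empty cover. *)
Definition leb_outer (A : set 'rV[R]_d) : \bar R :=
  ereal_inf [set \esum_(p in D) (box_vol p)%:E | D in
    [set D : set box | countable D /\ A `<=` \bigcup_(p in D) box_set p]].

Lemma box_vol_ge0 p : 0 <= box_vol p.
Proof. by apply: prodr_ge0 => i _; rewrite le_max lexx. Qed.

Local Open Scope ereal_scope.

Lemma leb_outer_ge0 A : 0 <= leb_outer A.
Proof.
apply: le_ereal_inf_tmp => _ [D _ <-].
by apply: esum_ge0 => p _; rewrite lee_fin box_vol_ge0.
Qed.

Lemma leb_outer0 : leb_outer set0 = 0.
Proof.
apply/eqP; rewrite eq_le leb_outer_ge0 andbT.
apply: ereal_inf_lbound; exists set0; last by rewrite esum_set0.
by split; [exact: countable0|exact: sub0set].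
Qed.

Lemma le_leb_outer : {homo leb_outer : A B / A `<=` B >-> A <= B}.
Proof.
move=> A B AB; apply: ereal_inf_le_tmp => _ [D [cD BD] <-].
by exists D => //; split => //; exact: subset_trans BD.
Qed.

Lemma leb_outer_family (I : choiceType) (D : set I) (b : I -> box)
    (A : set 'rV[R]_d) : countable D -> A `<=` \bigcup_(i in D) box_set (b i) ->
  leb_outer A <= \esum_(i in D) (box_vol (b i))%:E.
Proof.
move=> cD AD; pose E := b @` D.
have [D0|/set0P[i0 Di0]] := eqVneq D set0.
  move: AD; rewrite D0 bigcup_set0 subset0 => ->.
  by rewrite leb_outer0 esum_set0.
have exg p : exists i, E p -> D i /\ b i = p.
  have [[i Di <-]|nEp] := pselect (E p); first by exists i.
  by exists i0.
have [g gP] := choice exg.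
apply: (@le_trans _ _ (\esum_(p in E) (box_vol p)%:E)).
  apply: ereal_inf_lbound; exists E => //; split.
    exact: (sub_countable (card_image_le _ _)).
  by move=> x /AD[i Di xi]; exists (b i) => //; exists i.
apply: (@le_trans _ _ (\esum_(i in g @` E) (box_vol (b i))%:E)).
  rewrite [leRHS]esum_image.
    by apply: le_esum => p /gP[_ ->].
  move=> p q; rewrite !inE => /gP[_ bp] /gP[_ bq] gpq.
  by rewrite -bp -bq gpq.
rewrite esum_mkcond [leRHS]esum_mkcond; apply: le_esum => i _.
case: ifPn; last by case: ifPn => // _ _; rewrite lee_fin box_vol_ge0.
rewrite inE => -[p /gP[Dg _] <-]; by rewrite mem_set.
Qed.

Lemma leb_outer_sigma_subadditive : sigma_subadditive leb_outer.
Proof.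
move=> A; have [[i ioo]|] := pselect (exists i, leb_outer (A i) = +oo).
  rewrite (eseries_pinfty _ _ ioo) ?leey// => n _.
  by rewrite -ltNye (lt_le_trans _ (leb_outer_ge0 _)).
rewrite -forallNE => Aoo.
suff add2e (e : {posnum R}) :
    leb_outer (\bigcup_n A n) <= \sum_(i <oo) leb_outer (A i) + e%:num%:E.
  by apply/lee_addgt0Pr => _/posnumP[].
rewrite (le_trans _ (epsilon_trick _ _ _))//; last first.
  by move=> n; exact: leb_outer_ge0.
pose P n (D : set box) :=
  (countable D /\ A n `<=` \bigcup_(p in D) box_set p) /\
  \esum_(p in D) (box_vol p)%:E <= leb_outer (A n) + (e%:num / (2 ^ n.+1)%:R)%:E.
have [G PG] : {G : (set box)^nat & forall n, P n (G n)}.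
  apply: (@choice _ _ P) => n.
  have en : (0 < e%:num / (2 ^ n.+1)%:R :> R)%R by [].
  have fA : leb_outer (A n) \is a fin_num.
    rewrite ge0_fin_numE ?leb_outer_ge0//.
    by rewrite ltey; apply/eqP; exact: Aoo.
  have [_ [D DA <-] Dlt] := lb_ereal_inf_adherent en fA.
  by exists D; split => //; exact: ltW.
apply: (@le_trans _ _
    (\esum_(k in [set: nat] `*`` G) (box_vol k.2)%:E)).
  apply: leb_outer_family.
    by apply: countableXR => [|n _]; [exact: countableP|case: (PG n) => -[]].
  move=> x [n _ Ax]; have [[_ AG] _] := PG n.
  by have [p Gp xp] := AG _ Ax; exists (n, p).
rewrite -(@esum_esum _ _ _ setT G (fun _ p => (box_vol p)%:E)); last first.
  by move=> *; rewrite lee_fin box_vol_ge0.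
rewrite -nneseries_esumT; last first.
  by move=> n; apply: esum_ge0 => p _; rewrite lee_fin box_vol_ge0.
apply: lee_nneseries => n _; last by case: (PG n).
by move=> _; apply: esum_ge0 => p _; rewrite lee_fin box_vol_ge0.
Qed.

HB.instance Definition _ := isOuterMeasure.Build R 'rV[R]_d leb_outer
  leb_outer0 leb_outer_ge0 le_leb_outer leb_outer_sigma_subadditive.

Definition Rd : measurableType _ := caratheodory_type leb_outer.

Definition leb : set Rd -> \bar R := leb_outer.

HB.instance Definition _ := isMeasure.Build _ Rd R leb
  (caratheodory_measure0 _) (@caratheodory_measure_ge0 _ _ leb_outer)
  (@caratheodory_measure_sigma_additive _ _ leb_outer).

Lemma halfspace_measurable (i : 'I_d) (c : R) :
  measurable ([set x | x ord0 i <= c]%R : set Rd).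
Proof.
set H := (X in measurable X).
apply: le_caratheodory_measurable => X.
apply: le_ereal_inf_tmp => _ [D [cD XD] <-].
pose lo (p : box) : box :=
  (p.1, \row_j if j == i then Num.min (p.2 ord0 i) c else p.2 ord0 j).
pose hi (p : box) : box :=
  (\row_j if j == i then Num.max (p.1 ord0 i) c else p.1 ord0 j, p.2).
have volE p : box_vol p = (box_vol (lo p) + box_vol (hi p))%R.
  pose V (q : box) : R := (\prod_(j < d | j != i) Num.max 0 (q.2 ord0 j - q.1 ord0 j))%R.
  have boxE q : box_vol q = (Num.max 0 (q.2 ord0 i - q.1 ord0 i) * V q)%R.
    by rewrite /box_vol (bigD1 i).
  have Vlo : V (lo p) = V p.
    by apply: eq_bigr => j ji; rewrite !mxE (negbTE ji).
  have Vhi : V (hi p) = V p.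
    by apply: eq_bigr => j ji; rewrite !mxE (negbTE ji).
  rewrite !boxE Vlo Vhi !mxE eqxx.
  rewrite -mulrDl; congr (_ * _)%R.
  move: (p.1 ord0 i) (p.2 ord0 i) => a b.
  rewrite !maxEle minEle.
  by do !case: ifPn; rewrite -?ltNge => *; lra.
have -> : \esum_(p in D) (box_vol p)%:E =
    \esum_(p in D) (box_vol (lo p))%:E + \esum_(p in D) (box_vol (hi p))%:E.
  rewrite -esumD => [|p _|p _]; rewrite ?lee_fin ?box_vol_ge0//.
  by apply: eq_esum => p _; rewrite volE EFinD.
apply: leeD; apply: leb_outer_family => // x [/XD[p Dp xp] Hx]; exists p => // j.
- have := xp j; rewrite mxE; case: eqP => [->|//] /andP[-> /=].
  by rewrite le_min => ->.
- have := xp j; rewrite mxE; case: eqP => [->|//] /andP[? ->].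
  by rewrite andbT gt_max; apply/andP; split => //; rewrite ltNge; exact/negP.
Qed.

Lemma leb_sigma_finite : sigma_finite [set: Rd] leb.
Proof.
pose p n : box := (\row__ - n%:R, \row__ n%:R)%R.
have pE n : box_set (p n) =
    \bigcap_(i : 'I_d) ([set x | x ord0 i <= n%:R]%R `\`
                        [set x | x ord0 i <= - n%:R]%R).
  apply/seteqP; split => [x xp i _|x xp i].
    have := xp i; rewrite !mxE => /andP[ax xb]; split => //=.
    by apply/negP; rewrite -ltNge.
  have [/= xb /negP ax] := xp i Logic.I; rewrite !mxE xb andbT.
  by rewrite ltNge.
exists (fun n => box_set (p n)); last first.
  move=> n; split; last first.
    apply: (@le_lt_trans _ _ (\esum_(q in [set p n]) (box_vol q)%:E)).
      by apply: leb_outer_family => // x; exists (p n).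
    by rewrite esum_set1 ?ltry// lee_fin box_vol_ge0.
  rewrite pE; apply: fin_bigcap_measurable => // i _.
  by apply: measurableD; exact: halfspace_measurable.
apply/esym/seteqP; split => // x _.
exists (Num.truncn `|x|).+1 => // i; rewrite !mxE.
have := truncnS_gt `|x| => xn.
have xi : (`|x ord0 i| <= `|x|)%R.
  by rewrite [leRHS]/Num.norm/= mx_normrE (le_bigmax _ _ (ord0, i)).
have := le_lt_trans xi xn; rewrite ltr_norml => /andP[-> /ltW ->//].
Qed.

HB.instance Definition _ := Measure_isSigmaFinite.Build _ Rd R leb
  leb_sigma_finite.

(* Lebesgue measure on R^d x R^d, on the Lebesgue-measurable sets: the
   completion of the product measure. *)
Definition Rd2 : measurableType _ :=
  caratheodory_type (mu_ext (leb \x leb)).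

Definition leb2 : set Rd2 -> \bar R :=
  @completed_measure_extension _ _ _ (leb \x leb).

HB.instance Definition _ := Measure.on leb2.

End LebesgueMeasure.

Arguments leb {R d}.
Arguments leb2 {R d}.

Section NonlocalNeumann.
Context (R : realType) (d : nat).
Implicit Types (Omega : set (Rd R d)) (gamma : Rd R d -> Rd R d -> R).
Local Open Scope ereal_scope.

(* Elements of L^p(Omega) are represented by functions on R^d; only their
   values on Omega matter. *)
Definition Lp_on Omega (p : \bar R) (f : Rd R d -> R) : Prop :=
  f \_ Omega \in Lfun leb p.

Definition Linfty_norm_on Omega (g : Rd R d -> \bar R) : \bar R :=
  'N[leb]_+oo [g \_ Omega].

Definition Gamma_set Omega gamma : set (Rd R d) :=
  [set y | ~ Omega y /\ 0 < \int[leb]_(x in Omega) (gamma y x)%:E].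

Definition hatGamma_set Omega gamma : set (Rd R d) :=
  [set y | ~ Omega y /\ 0 < \int[leb]_(x in Omega) (gamma y x + gamma x y)%:E].

Definition V_sqnorm Omega gamma (v : Rd R d -> R) : \bar R :=
  \int[leb]_(x in Omega) (v x ^+ 2)%:E +
  \int[leb]_(x in Omega) \int[leb]_y ((v x - v y) ^+ 2 * gamma y x)%:E.

(* V_space consists of representatives: the elements of V(Omega; gamma) are
   its classes modulo V_eq. *)
Definition V_space Omega gamma : set (Rd R d -> R) :=
  [set v | measurable_fun setT v /\ V_sqnorm Omega gamma v < +oo].

Definition V_eq Omega gamma (v w : Rd R d -> R) : Prop :=
  {ae leb, forall x, (Omega `|` Gamma_set Omega gamma) x -> v x = w x}.

End NonlocalNeumann.

(* Main.v *)
Require Import Defs.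
From mathcomp Require Import all_boot all_order all_algebra.
From mathcomp Require Import all_classical all_reals all_analysis.
From mathcomp Require Import measurable_realfun ess_sup_inf.
From mathcomp Require Import ring lra.

(** The bilinear form of the Neumann problem is bounded on V and coercive, and
    V is complete, so that the Lax-Milgram lemma yields the solution.

    Coercivity: (u(x) K(x,y) - u(y) K(y,x)) (u(x) - u(y)) equals
    (u(x) - u(y))^2 K(y,x) + u(x) (u(x) - u(y)) (K(x,y) - K(y,x)).  On
    Omega x Omega the second summand integrates to the integral of
    u(x)^2 (K(x,y) - K(y,x)), since u(x) u(y) (K(x,y) - K(y,x)) is antisymmetric.
    On Omega x W, with W the nonlocal boundary, |K(x,y) - K(y,x)| is at most
    (C + 1) K(y,x), and Young's inequality absorbs half of the first summand;
    the rest is controlled by the lower bound on alpha.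

    Completeness: a fast Cauchy sequence converges almost everywhere on Omega,
    and its increments converge almost everywhere where K(y,x) <> 0; Fatou's
    lemma does the rest. *)

Set Implicit Arguments.
Unset Strict Implicit.
Unset Printing Implicit Defensive.

Import Order.TTheory GRing.Theory Num.Theory.
Import numFieldNormedType.Exports.

Local Open Scope classical_set_scope.
Local Open Scope ring_scope.

(** * The Lax-Milgram lemma *)

Section LaxMilgram.
Context (R : realType) (E : lmodType R) (V : set E).

(** Elements of V are kept as functions, without identification, so the energy is only a seminorm:
    the Lax-Milgram lemma is stated for a subset [V] of a vector space with a semidefinite [dot],
    and limits and representers are determined up to vectors of zero energy.

    The kernel is measurable only for the completion of the product measure, so Tonelli's theorem
    does not apply to it directly. Off a null set it is measurable for the product sigma-algebra; it
    is set to zero on that null set, and all iterated integrals survive because Lebesgue measure on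
    each factor is complete.

    The constant (C + 1)/2 in the lower bound on alpha is the Young weight that leaves half of the
    energy on Omega x W. On Omega x Omega half remains too, because of the factor 1/2 in the weak
    form. These two regions carry all the energy: by the very definition of W, K(y,x) vanishes
    almost everywhere for x in Omega and y outside both sets. *)

Definition linear_on (G : E -> R) :=
  forall a u v, V u -> V v -> G (a *: u + v) = a * G u + G v.

Definition bilinear_on (s : E -> E -> R) :=
  (forall w, V w -> linear_on (s ^~ w)) /\ (forall w, V w -> linear_on (s w)).

Variable dot : E -> E -> R.
Local Notation q u := (dot u u).

(** By homogeneity this is equivalent, up to the constant, to a bound by the product of the
    seminorms. The additive form is what |a| |b| <= a^2 + b^2 gives under an integral. *)
Definition bounded_form (K : R) (s : E -> E -> R) :=
  forall u v, V u -> V v -> `|s u v| <= K * (q u + q v).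

Definition bounded_functional (K : R) (G : E -> R) :=
  forall v, V v -> `|G v| <= K * (1 + q v).

Hypothesis V0 : V 0.
Hypothesis VS : forall a u v, V u -> V v -> V (a *: u + v).
Hypothesis dotL : bilinear_on dot.
Hypothesis dotC : forall u v, V u -> V v -> dot u v = dot v u.
Hypothesis dot_ge0 : forall u, V u -> 0 <= q u.
(** The factor 2 is there because the energy will be a sum of two integrals, each passing to the
    limit with its own bound 4^-n. As [dot] may be degenerate, the limit need not be unique. *)
Hypothesis complete : forall u_ : nat -> E, (forall n, V (u_ n)) ->
  (forall n m, (n <= m)%N -> q (u_ n - u_ m) <= 4^-1 ^+ n) ->
  exists2 u, V u & forall n, q (u_ n - u) <= 2 * 4^-1 ^+ n.

Lemma linear_on0 G : linear_on G -> G 0 = 0.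
Proof. by move=> /(_ (-1) 0 0 V0 V0); rewrite scaler0 addr0 mulN1r addNr. Qed.

Lemma linear_onZ G a u : linear_on G -> V u -> G (a *: u) = a * G u.
Proof.
move=> GL Vu; have := GL a u 0 Vu V0.
by rewrite addr0 (linear_on0 GL) addr0.
Qed.

Lemma linear_onB G u v : linear_on G -> V u -> V v -> G (u - v) = G u - G v.
Proof.
by move=> GL Vu Vv; rewrite addrC -scaleN1r GL// mulN1r addrC.
Qed.

Lemma subspaceZ a u : V u -> V (a *: u).
Proof. by move=> Vu; rewrite -[_ *: _]addr0; exact: VS. Qed.

Lemma subspaceB u v : V u -> V v -> V (u - v).
Proof. by move=> Vu Vv; rewrite addrC -scaleN1r; exact: VS. Qed.

Lemma form_sqrD s a u v : bilinear_on s -> V u -> V v ->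
  s (a *: u + v) (a *: u + v) = a ^+ 2 * s u u + a * (s u v + s v u) + s v v.
Proof.
move=> [sl sr] Vu Vv; have VD := VS a Vu Vv.
by rewrite (sl _ VD a u v Vu Vv) (sr u Vu a u v) ?(sr v Vv a u v) //; ring.
Qed.

(** Replacing u by sqrt(t) u and v by v / sqrt(t) leaves s unchanged and weighs the two energies
    against each other. The free [t] does the work of the Cauchy-Schwarz inequality. *)
Lemma bounded_form_scale K s (t : R) u v : bilinear_on s -> bounded_form K s ->
  0 < t -> V u -> V v -> `|s u v| <= K * (t * q u + q v / t).
Proof.
move=> [sl sr] sK t0 Vu Vv.
have r0 : 0 < Num.sqrt t by rewrite sqrtr_gt0.
have rr : Num.sqrt t ^+ 2 = t by rewrite sqr_sqrtr// ltW.
move: (Num.sqrt t) r0 rr => r r0 <-.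
have rn0 : r != 0 by rewrite gt_eqF.
have := sK _ _ (subspaceZ r Vu) (subspaceZ r^-1 Vv).
case: dotL => dl dr.
rewrite (linear_onZ _ (sl _ (subspaceZ r^-1 Vv)))// (linear_onZ _ (sr _ Vu))//.
rewrite (linear_onZ _ (dl _ (subspaceZ r Vu)))// (linear_onZ _ (dr _ Vu))//.
rewrite (linear_onZ _ (dl _ (subspaceZ r^-1 Vv)))// (linear_onZ _ (dr _ Vv))//.
rewrite !mulrA divff// mul1r => /le_trans; apply.
by rewrite -expr2 -expr2 exprVn [_ / _]mulrC.
Qed.

Lemma bounded_functional_scale K G (t : R) v : linear_on G ->
  bounded_functional K G -> 0 < t -> V v -> `|G v| <= K * (t + q v / t).
Proof.
move=> GL GK t0 Vv; have tn0 : t != 0 by rewrite gt_eqF.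
have := GK _ (subspaceZ t^-1 Vv); case: dotL => dl dr.
rewrite (linear_onZ _ GL)// (linear_onZ _ (dl _ (subspaceZ t^-1 Vv)))//.
rewrite (linear_onZ _ (dr _ Vv))// normrM (gtr0_norm (_ : 0 < t^-1)) ?invr_gt0//.
rewrite -(ler_pM2l t0) mulrA divff// mul1r => /le_trans; apply.
by rewrite le_eqVlt; apply/orP; left; apply/eqP; field.
Qed.

(* The energy J v = s v v / 2 - G v is bounded below; by the parallelogram law
   its minimizing sequences are Cauchy. *)
Lemma symmetric_form_represents K a s G : 0 < a -> bilinear_on s ->
  (forall u v, V u -> V v -> s u v = s v u) -> bounded_form K s ->
  (forall u, V u -> a * q u <= s u u) ->
  linear_on G -> bounded_functional K G ->
  exists2 u, V u & forall v, V v -> s u v = G v.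
Proof.
move=> a0 sL sC sK sa GL GK.
have [sl sr] := sL.
have [k k0 Kk] : exists2 k, 0 < k & K <= k.
  by exists (Num.max K 1); rewrite ?le_max ?lexx// lt_max ltr01 orbT.
have {}sK : bounded_form k s.
  move=> u v Vu Vv; apply: le_trans (sK _ _ Vu Vv) _.
  by rewrite ler_wpM2r// addr_ge0// dot_ge0.
have {}GK : bounded_functional k G.
  move=> v Vv; apply: le_trans (GK _ Vv) _.
  by rewrite ler_wpM2r// addr_ge0// dot_ge0.
pose J v := 2^-1 * s v v - G v.
pose S := J @` V.
have S0 : S !=set0 by exists (J 0); exists 0.
have lbS : has_lbound S.
  (* With t = 2k/a, [bounded_functional_scale] costs a q(v)/2, which s(v,v)/2 absorbs; the remaining
     constant is the bound. *)
  exists (- (k * (2 * k / a))) => _ [v Vv <-]; rewrite /J.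
  have t0 : 0 < 2 * k / a by rewrite divr_gt0// mulr_gt0.
  have := bounded_functional_scale GL GK t0 Vv.
  have -> : k * (2 * k / a + q v / (2 * k / a)) = k * (2 * k / a) + 2^-1 * (a * q v).
    by field; rewrite !gt_eqF.
  by rewrite ler_norml => /andP[_ h]; have := sa _ Vv; lra.
have Jge v : V v -> inf S <= J v by move=> Vv; apply: ge_inf => //; exists v.
(* For w = u_n - u_m and the midpoint h of u_n and u_m, s(w,w) = 4 (J u_n + J u_m - 2 J h) <= 4 (e n
   + e m) <= 8 e n, whence the 8. *)
pose e n : R := a / 8 * 4^-1 ^+ n.
have e0 n : 0 < e n by rewrite mulr_gt0 ?divr_gt0// exprn_gt0// invr_gt0.
have {S0 lbS} /choice[u_ uP] n : exists u, V u /\ J u < inf S + e n.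
  have [_ [v Vv <-] Jv] := inf_adherent (e0 n) (conj S0 lbS).
  by exists v.
have Vu n : V (u_ n) by case: (uP n).
have Ju n : J (u_ n) < inf S + e n by case: (uP n).
have ele n m : (n <= m)%N -> e m <= e n.
  by move=> nm; rewrite ler_pM2l ?divr_gt0// ler_wiXn2l//; lra.
have cau n m : (n <= m)%N -> q (u_ n - u_ m) <= 4^-1 ^+ n.
  move=> nm; rewrite -(ler_pM2l a0).
  apply: le_trans (sa _ (subspaceB (Vu n) (Vu m))) _.
  have Vh := subspaceZ 2^-1 (VS 1 (Vu n) (Vu m)).
  have := Jge _ Vh; have := Ju n; have := Ju m; have := ele _ _ nm.
  rewrite /J (linear_onZ _ GL) ?GL//; last exact: VS.
  rewrite (linear_onZ _ (sl _ Vh)) ?(linear_onZ _ (sr _ _)) ?form_sqrD//; try exact: VS.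
  rewrite -[u_ n - u_ m]addrC -scaleN1r form_sqrD// (sC (u_ m) (u_ n))//.
  rewrite /e; move: (_ ^+ n) (_ ^+ m) => en em; lra.
have [u Vu' uu] := complete Vu cau.
exists u => // v Vv; set d := s u v - G v; pose S2 := 2^-1 * s v v.
(* The right side is J (u + t v) - J u: this is minimality along v. At t = - d / (1 + S2) it equals
   - d^2 / (1 + S2)^2; the 1 guards against S2 = 0. *)
suff h t : 0 <= t * d + t ^+ 2 * S2.
  apply/eqP; rewrite -subr_eq0 -/d; apply/negPn/negP => d0.
  have S20 : 0 <= S2.
    by rewrite mulr_ge0// (le_trans _ (sa _ Vv))// mulr_ge0 ?dot_ge0// ltW.
  have S21 : 0 < 1 + S2 by lra.
  have := h (- d / (1 + S2)).
  have -> : - d / (1 + S2) * d + (- d / (1 + S2)) ^+ 2 * S2 =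
      - (d ^+ 2 / (1 + S2) ^+ 2) by field; rewrite gt_eqF.
  by rewrite oppr_ge0 leNgt divr_gt0 ?exprn_even_gt0//= ?d0// gt_eqF.
apply/ler_addgt0Pr => eps eps0.
pose c := a / 8 + `|t| * k * (2 + q v).
have [n hn] : exists n, 2^-1 ^+ n * c <= eps.
  have : (fun n => 2^-1 ^+ n * c) @ \oo --> (0 * c : R).
    apply: cvgM; last exact: cvg_cst.
    by apply: cvg_expr; rewrite gtr0_norm ?invr_gt0// invf_lt1//; lra.
  rewrite mul0r => /cvgrPdist_le/(_ _ eps0)[n _ /(_ n (leqnn n))] /=.
  by rewrite sub0r normrN => /(le_trans (ler_norm _)) ?; exists n.
have Vd : V (u_ n - u) by exact: subspaceB.
(* Comparing J at t v + u_n with J at u_n gives the inequality for u_n up to e n, so only s (u_n) v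
   has to pass to the limit, never J. The scale 2^n makes both terms of the bound of order 2^-n. *)
have J1 := Jge _ (VS t Vv (Vu n)).
have := Ju n; move: J1; rewrite /J GL// form_sqrD// (sC v (u_ n))//.
have t20 : 0 < 2 ^+ n :> R by rewrite exprn_gt0.
have := bounded_form_scale sL sK t20 Vd Vv.
rewrite (linear_onB (sl _ Vv))// => h1 h2 h3.
have h4 : `|s (u_ n) v - s u v| <= k * (2 + q v) * 2^-1 ^+ n.
  apply: le_trans h1 _; rewrite -mulrA ler_pM2l//.
  have : 2 ^+ n * q (u_ n - u) <= 2 ^+ n * (2 * 4^-1 ^+ n) by rewrite ler_pM2l.
  rewrite mulrCA.
  have -> : 2 ^+ n * 4^-1 ^+ n = 2^-1 ^+ n :> R by rewrite -exprMn; congr (_ ^+ _); field.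
  by rewrite exprVn => h; rewrite mulrDl lerD2r.
have h5 : `|t * (s (u_ n) v - s u v)| <= `|t| * k * (2 + q v) * 2^-1 ^+ n.
  by rewrite normrM -!mulrA ler_wpM2l// mulrA.
have h6 : e n <= a / 8 * 2^-1 ^+ n.
  rewrite /e ler_pM2l ?divr_gt0// lerXn2r ?nnegrE ?invr_ge0//; lra.
move: h5 hn; rewrite ler_norml => /andP[_]; rewrite /c /d /S2; move: h6 h2 h3.
lra.
Qed.

(** Let A u and f represent B u and F. The equation A u = f is solved through its normal equations:
    the symmetric form dot (A u) (A v) is coercive with constant a^2 and represents v |-> B v f. The
    residual w = A u - f then satisfies B z w = 0 for all z, and z = w with coercivity gives q w =
    0. *)
Lemma lax_milgram K a B F : 0 < a -> bilinear_on B -> bounded_form K B ->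
  (forall u, V u -> a * q u <= B u u) ->
  linear_on F -> bounded_functional K F ->
  exists2 u, V u & forall v, V v -> B u v = F v.
Proof.
move=> a0 BL BK Ba FL FK; have [Bl Br] := BL; have [dl dr] := dotL.
have [k k0 Kk] : exists2 k, 0 < k & K <= k.
  by exists (Num.max K 1); rewrite ?le_max ?lexx// lt_max ltr01 orbT.
have {}BK : bounded_form k B.
  move=> u v Vu Vv; apply: le_trans (BK _ _ Vu Vv) _.
  by rewrite ler_wpM2r// addr_ge0// dot_ge0.
have dotK : bounded_form 2^-1 dot.
  move=> u v Vu Vv; rewrite ler_norml.
  have := dot_ge0 (VS 1 Vu Vv); have := dot_ge0 (VS (-1) Vu Vv).
  by rewrite !form_sqrD// (dotC Vv Vu); lra.
have riesz G : linear_on G -> (exists K', bounded_functional K' G) ->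
    exists2 u, V u & forall v, V v -> dot u v = G v.
  move=> GL [K' GK].
  apply: (@symmetric_form_represents (Num.max 2^-1 K') 1) => //.
  - move=> u v Vu Vv; apply: le_trans (dotK _ _ Vu Vv) _.
    by rewrite ler_wpM2r ?le_max ?lexx// addr_ge0// dot_ge0.
  - by move=> u; rewrite mul1r.
  - move=> v Vv; apply: le_trans (GK _ Vv) _.
    by rewrite ler_wpM2r ?le_max ?lexx ?orbT// addr_ge0// dot_ge0.
have fixB w : V w -> exists K', bounded_functional K' (B w).
  move=> Vw; exists (k * (1 + q w)) => v Vv; apply: le_trans (BK _ _ Vw Vv) _.
  rewrite -mulrA ler_pM2l//.
  by have := mulr_ge0 (dot_ge0 Vw) (dot_ge0 Vv); have := dot_ge0 Vw; lra.
have [A AP] : exists A : E -> E, forall u, V u ->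
    V (A u) /\ forall v, V v -> dot (A u) v = B u v.
  have /choice[A AP] : forall u, exists w, V u ->
      V w /\ forall v, V v -> dot w v = B u v.
    move=> u; have [Vu|nVu] := pselect (V u); last by exists 0.
    by have [w Vw wP] := riesz _ (Br _ Vu) (fixB _ Vu); exists w.
  by exists A.
have VA u : V u -> V (A u) by move=> /AP[].
have AE u v : V u -> V v -> dot (A u) v = B u v by move=> /AP[_]; exact.
have [f Vf fP] := riesz _ FL (ex_intro (bounded_functional ^~ F) K FK).
have qA u : V u -> q (A u) <= 4 * k ^+ 2 * q u.
  (* q(A u) = B u (A u), and t = 2k leaves q(A u)/2 on the right, to be absorbed. *)
  move=> Vu; have t0 : 0 < 2 * k by rewrite mulr_gt0.
  have := bounded_form_scale BL BK t0 Vu (VA _ Vu); rewrite -AE//; last exact: VA.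
  have -> : k * (2 * k * q u + q (A u) / (2 * k)) =
      2 * k ^+ 2 * q u + q (A u) / 2 by field; rewrite gt_eqF.
  by rewrite ler_norml => /andP[_]; lra.
have Aq u : V u -> a ^+ 2 * q u <= q (A u).
  move=> Vu; have := bounded_form_scale dotL dotK a0 Vu (VA _ Vu).
  rewrite (dotC Vu (VA _ Vu)) (AE _ _ Vu Vu) ler_norml => /andP[_ h].
  have : a * (a * q u) <= a * (2^-1 * (a * q u + q (A u) / a)).
    by rewrite ler_pM2l// (le_trans (Ba _ Vu) h).
  have -> : a * (2^-1 * (a * q u + q (A u) / a)) =
    2^-1 * (a ^+ 2 * q u + q (A u)) by field; rewrite gt_eqF.
  by rewrite mulrA -expr2; lra.
have [|||||||u Vu uP] := @symmetric_form_represents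
    (Num.max (2 * k ^+ 2) (k * (1 + q f))) (a ^+ 2)
    (fun u v => dot (A u) (A v)) (B ^~ f).
- by rewrite exprn_gt0.
(* [A] is chosen pointwise and need not be linear; [dot (A u) v], being [B u v], is linear in u,
   which suffices. *)
- split=> w Vw b u v Vu Vv; first by rewrite !AE ?Bl//; try exact: VA; exact: VS.
  rewrite !(dotC (VA _ Vw)); try (exact: VA); last exact/VA/VS.
  by rewrite !AE ?Bl//; try exact: VA; exact: VS.
- by move=> u v Vu Vv; apply: dotC; exact: VA.
- move=> u v Vu Vv; apply: le_trans (dotK _ _ (VA _ Vu) (VA _ Vv)) _.
  apply: (@le_trans _ _ (2 * k ^+ 2 * (q u + q v))).
    by have := qA _ Vu; have := qA _ Vv; lra.
  by rewrite ler_wpM2r ?le_max ?lexx// addr_ge0// dot_ge0.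
- exact: Aq.
- exact: Bl.
- move=> v Vv; apply: (@le_trans _ _ (k * (1 + q f) * (1 + q v))).
    apply: le_trans (BK _ _ Vv Vf) _; rewrite -mulrA ler_pM2l//.
    by have := mulr_ge0 (dot_ge0 Vf) (dot_ge0 Vv); have := dot_ge0 Vf; lra.
  by rewrite ler_wpM2r ?le_max ?lexx ?orbT// addr_ge0// dot_ge0.
exists u => // v Vv; pose w := A u - f.
have Vw : V w by apply: subspaceB => //; exact: VA.
have Bw z : V z -> B z w = 0.
  move=> Vz; rewrite -AE// (linear_onB (dr _ (VA _ Vz)))//; last exact: VA.
  by rewrite (dotC (VA _ Vz)) ?uP ?AE ?subrr//; exact: VA.
have qw : q w = 0.
  apply/eqP; rewrite eq_le dot_ge0// andbT -(ler_pM2l a0) mulr0 -(Bw w)//.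
  exact: Ba.
(* With [dot] only semidefinite, q w = 0 does not give w = 0, but it kills every pairing: t = (1 + q
   v)/eps brings the scaled bound below eps. *)
have : dot w v = 0.
  apply/eqP; rewrite -normr_eq0 eq_le normr_ge0 andbT.
  apply/ler_addgt0Pr => eps eps0; rewrite add0r.
  have t0 : 0 < (1 + q v) / eps by rewrite divr_gt0// ltr_wpDr// dot_ge0.
  have := bounded_form_scale dotL dotK t0 Vw Vv.
  rewrite qw mulr0 add0r => /le_trans; apply.
  have qv := dot_ge0 Vv.
  have -> : 2^-1 * (q v / ((1 + q v) / eps)) = q v / (2 * (1 + q v)) * eps.
    by field; rewrite !gt_eqF//; lra.
  by rewrite -[leRHS]mul1r ler_pM2r// ler_pdivrMr; lra.
rewrite (linear_onB (dl _ Vv)) ?AE ?fP//; last exact: VA.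
by move/eqP; rewrite subr_eq0 => /eqP.
Qed.

End LaxMilgram.

(** * Product rectangles and weighted squares *)

Section ProductRectangles.
Context d (T : measurableType d) (R : realType).
Variable mu : {sigma_finite_measure set T -> \bar R}.
Implicit Types (A B : set T) (f : T * T -> \bar R).
Local Open Scope ereal_scope.

(** Extension by zero off a rectangle carries the Fubini and Tonelli theorems from the whole product
    to A x B. *)
Lemma integral_restrict_setX1 f A B :
  (fun x => \int[mu]_y (f \_ (A `*` B)) (x, y)) =
  (fun x => \int[mu]_(y in B) f (x, y)) \_ A.
Proof.
apply/funext => x; rewrite [RHS]patchE; case: ifPn => [|/negP] Ax.
  rewrite [RHS]integral_mkcond; apply: eq_integral => y _.
  by rewrite !patchE in_setX /= Ax.
rewrite -[RHS](@integral0 _ _ _ mu setT); apply: eq_integral => y _.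
by rewrite patchE in_setX /= (negbTE (introN idP Ax)).
Qed.

Lemma integral_restrict_setX2 f A B :
  (fun y => \int[mu]_x (f \_ (A `*` B)) (x, y)) =
  (fun y => \int[mu]_(x in A) f (x, y)) \_ B.
Proof.
apply/funext => y; rewrite [RHS]patchE; case: ifPn => [|/negP] By.
  rewrite [RHS]integral_mkcond; apply: eq_integral => x _.
  by rewrite !patchE in_setX /= By andbT.
rewrite -[RHS](@integral0 _ _ _ mu setT); apply: eq_integral => x _.
by rewrite patchE in_setX /= (negbTE (introN idP By)) andbF.
Qed.

Section tonelli.
Variables (A B : set T) (f : T * T -> \bar R).
Hypotheses (mA : measurable A) (mB : measurable B).
Hypotheses (mf : measurable_fun setT f) (f0 : forall z, 0 <= f z).

Let mfAB : measurable_fun setT (f \_ (A `*` B)).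
Proof.
apply/(measurable_restrictT _ (measurableX mA mB)).
exact: measurable_funS mf.
Qed.

Let fAB0 z : 0 <= (f \_ (A `*` B)) z.
Proof. by rewrite patchE; case: ifP. Qed.

Lemma tonelli_setX1 : \int[mu \x mu]_(z in A `*` B) f z =
  \int[mu]_(x in A) \int[mu]_(y in B) f (x, y).
Proof.
rewrite integral_mkcond fubini_tonelli1// /fubini_F integral_restrict_setX1.
by rewrite -integral_mkcond.
Qed.

Lemma tonelli_setX2 : \int[mu \x mu]_(z in A `*` B) f z =
  \int[mu]_(y in B) \int[mu]_(x in A) f (x, y).
Proof.
rewrite integral_mkcond fubini_tonelli2// /fubini_G integral_restrict_setX2.
by rewrite -integral_mkcond.
Qed.

Lemma measurable_tonelli1 : measurable_fun A (fun x => \int[mu]_(y in B) f (x, y)).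
Proof.
apply/(measurable_restrictT _ mA).
by rewrite -integral_restrict_setX1; exact: measurable_fun_fubini_tonelli_F.
Qed.

Lemma measurable_tonelli2 : measurable_fun B (fun y => \int[mu]_(x in A) f (x, y)).
Proof.
apply/(measurable_restrictT _ mB).
by rewrite -integral_restrict_setX2; exact: measurable_fun_fubini_tonelli_G.
Qed.

End tonelli.

Section fubini.
Variables (A B : set T) (f : T * T -> \bar R).
Hypotheses (mA : measurable A) (mB : measurable B).
Hypothesis fi : (mu \x mu).-integrable (A `*` B) f.

Let fiAB : (mu \x mu).-integrable setT (f \_ (A `*` B)).
Proof. exact/(integrable_mkcond _ (measurableX mA mB)). Qed.

Lemma fubini_setX1 : \int[mu \x mu]_(z in A `*` B) f z =
  \int[mu]_(x in A) \int[mu]_(y in B) f (x, y).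
Proof.
rewrite integral_mkcond -integral12_prod_meas1// /fubini_F.
by rewrite integral_restrict_setX1 -integral_mkcond.
Qed.

Lemma fubini_setX2 : \int[mu \x mu]_(z in A `*` B) f z =
  \int[mu]_(y in B) \int[mu]_(x in A) f (x, y).
Proof.
rewrite integral_mkcond -integral21_prod_meas1// /fubini_G.
by rewrite integral_restrict_setX2 -integral_mkcond.
Qed.

Lemma integrable_fubini1 :
  mu.-integrable A (fun x => \int[mu]_(y in B) f (x, y)).
Proof.
apply/(integrable_mkcond _ mA); rewrite -integral_restrict_setX1.
exact: integrable_fubini_F.
Qed.

End fubini.

(** No integrability is assumed: the inner integral is by definition a difference of integrals of
    nonnegative functions, and Tonelli makes each of them measurable. *)
Lemma measurable_integral_setX1 A B f : measurable A -> measurable B ->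
  measurable_fun setT f ->
  measurable_fun A (fun x => \int[mu]_(y in B) f (x, y)).
Proof.
move=> mA mB mf; rewrite (_ : (fun x => _) =
    (fun x => \int[mu]_(y in B) f^\+ (x, y)) \- (fun x => \int[mu]_(y in B) f^\- (x, y))).
  apply: emeasurable_funB.
  - exact: (measurable_tonelli1 mA mB (measurable_funepos mf) (funepos_ge0 f)).
  - exact: (measurable_tonelli1 mA mB (measurable_funeneg mf) (funeneg_ge0 f)).
apply/funext => x; rewrite [LHS]integralE.
under eq_integral do rewrite funepos_comp/=.
by under [X in _ - X = _]eq_integral do rewrite funeneg_comp/=.
Qed.

(** A null set N gives the strip N x T, which is null even if T has infinite measure. *)
Lemma ae_fst (P : T -> Prop) :
  {ae mu, forall x, P x} -> {ae mu \x mu, forall z, P z.1}.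
Proof.
move=> [N [mN N0 PN]]; exists (N `*` setT); split => //.
- exact: measurableX.
- by apply: eq_trans (product_measure1E _ _ mN _) _ => //; rewrite [X in X * _]N0 mul0e.
- by move=> z /= nP; split => //; exact: PN.
Qed.

End ProductRectangles.

Lemma normM_le_sqrD (R : realDomainType) (a b : R) : `|a| * `|b| <= a ^+ 2 + b ^+ 2.
Proof.
rewrite -(real_normK (num_real a)) -(real_normK (num_real b)).
have := normr_ge0 a; have := normr_ge0 b; move: `|a| `|b| => x y y0 x0.
have := sqr_ge0 (x - y); have := mulr_ge0 x0 y0; rewrite !expr2; nra.
Qed.

(** * Almost-everywhere limits and weighted square-integrable functions *)

Section MeasureFacts.
Context d (T : measurableType d) (R : realType).
Variables (mu : {measure set T -> \bar R}) (D : set T).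
Hypothesis mD : measurable D.
Local Open Scope ereal_scope.

Lemma ae_Rintegral_ge0 (f : T -> R) : mu.-integrable D (EFin \o f) ->
  {ae mu, forall x, D x -> (0 <= f x)%R} -> (0 <= \int[mu]_(x in D) f x)%R.
Proof.
move=> fi f0; rewrite /Rintegral.
rewrite (@ae_eq_integral _ _ _ _ _ (fun x => `|(f x)%:E|))//.
- by apply: fine_ge0; exact: integral_ge0.
- exact: measurable_int fi.
- by apply: measurableT_comp => //; exact: measurable_int fi.
- by apply: filterS f0 => x f0 Dx; rewrite gee0_abs// lee_fin f0.
Qed.

Lemma ae_cvg_le_integral (F : nat -> T -> R) (f : T -> R) (c : \bar R) :
  (forall m, measurable_fun D (F m)) -> measurable_fun D f ->
  (forall m x, (0 <= F m x)%R) ->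
  {ae mu, forall x, D x -> F m x @[m --> \oo] --> f x} ->
  (forall m, \int[mu]_(x in D) (F m x)%:E <= c) ->
  \int[mu]_(x in D) (f x)%:E <= c.
Proof.
move=> mF mf F0 Ff Fc.
have mE m : measurable_fun D (EFin \o F m) by exact/measurable_EFinP.
have fE : \int[mu]_(x in D) (f x)%:E =
    \int[mu]_(x in D) limn_einf (fun m => (F m x)%:E).
  apply: ae_eq_integral => //; first exact/measurable_EFinP.
    have -> : (fun x => limn_einf (fun m => (F m x)%:E)) =
        (fun x => - limn_esup (fun m => - (F m x)%:E)).
      apply/funext => x; rewrite -limn_einfN; congr limn_einf.
      by apply/funext => m /=; rewrite opprK.
    apply: measurableT_comp => //; apply: measurable_fun_limn_esup => m.
    by apply: measurableT_comp => //; exact: mE.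
  apply: filterS Ff => x Ff Dx; have {}Ff := Ff Dx.
  have Ef : (F m x)%:E @[m --> \oo] --> (f x)%:E by apply/cvg_EFin => //; exact: nearW.
  by have [-> _] := cvg_limn_einf_sup Ef.
have F0' m x : D x -> 0 <= (EFin \o F m) x by rewrite /= lee_fin.
rewrite fE; apply: (le_trans (fatou mu mD mE F0')).
rewrite limn_einf_lim; apply: lime_le; first exact: is_cvg_einfs.
apply: nearW => m; apply: le_trans (Fc m).
by apply: ereal_inf_lbound; exists m => //=.
Qed.

(* The sum of 2^n h_n^2 w has a finite integral, hence is finite almost
   everywhere, so h_n decays geometrically where w <> 0. *)
Lemma ae_cvg_series_fast (h : nat -> T -> R) (w : T -> R) :
  (forall n, measurable_fun D (h n)) -> measurable_fun D w ->
  (forall x, (0 <= w x)%R) ->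
  (forall n, \int[mu]_(x in D) (h n x ^+ 2 * w x)%:E <= (4^-1 ^+ n)%:E) ->
  {ae mu, forall x, D x -> w x != 0%R -> cvgn (series (h ^~ x))}.
Proof.
move=> mh mw w0 hw.
pose F n x := (2 ^+ n * (h n x ^+ 2 * w x))%:E.
have F0 n x : 0 <= F n x.
  by rewrite lee_fin mulr_ge0 ?exprn_ge0// mulr_ge0 ?sqr_ge0.
have mhw n : measurable_fun D (fun x => (h n x ^+ 2 * w x)%:E).
  by apply/measurable_EFinP; apply: measurable_funM => //; exact: measurable_funX.
have mF n : measurable_fun D (F n).
  rewrite /F; under eq_fun do rewrite EFinM.
  exact: measurable_funeM.
have iF n : \int[mu]_(x in D) F n x <= (2^-1 ^+ n)%:E.
  rewrite /F; under eq_integral do rewrite EFinM.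
  rewrite ge0_integralZl_EFin ?exprn_ge0//; last first.
    by move=> x _; rewrite lee_fin mulr_ge0 ?sqr_ge0.
  apply: (@le_trans _ _ ((2 ^+ n)%:E * (4^-1 ^+ n)%:E)).
    by rewrite lee_wpmul2l// lee_fin exprn_ge0.
  by rewrite -EFinM -exprMn lee_fin lerXn2r ?nnegrE//; lra.
have Fi : mu.-integrable D (fun x => \sum_(n <oo) F n x).
  apply/integrableP; split; first exact: ge0_emeasurable_sum.
  under eq_integral do rewrite gee0_abs ?nneseries_ge0//.
  rewrite integral_nneseries//.
  apply: (@le_lt_trans _ _ (\sum_(n <oo) (2^-1 ^+ n)%:E)).
    apply: lee_nneseries => [n _ _|n _]; last exact: iF.
    by apply: integral_ge0 => x _; exact: F0.
  have -> : \sum_(n <oo) (2^-1 ^+ n)%:E = (1 / (1 - 2^-1))%:E :> \bar R.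
    have gc : series (geometric 1 2^-1) @ \oo --> (1 / (1 - 2^-1) : R)%R.
      by apply: cvg_geometric_series; rewrite gtr0_norm; lra.
    have Eg : (series (geometric 1 2^-1) n)%:E @[n --> \oo] -->
        (1 / (1 - 2^-1) : R)%:E by apply/cvg_EFin => //; exact: nearW.
    apply/cvg_lim => //; apply: cvg_trans Eg; apply: near_eq_cvg; apply: nearW => n.
    by rewrite /series/= -sumEFin; apply: eq_bigr => i _; rewrite mul1r.
  exact: ltry.
apply: filterS (integrable_ae mD Fi) => x fin Dx wx.
have {}fin := fin Dx.
set L := fine (\sum_(n <oo) F n x).
have L0 : (0 <= L)%R by apply: fine_ge0; exact: nneseries_ge0.
have FL n : (2 ^+ n * (h n x ^+ 2 * w x) <= L)%R.
  rewrite -lee_fin fineK//.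
  apply: le_trans (nneseries_lim_ge n.+1 _) => //.
  rewrite big_nat_recr//= leeDr//.
  exact: sume_ge0.
have wx0 : (0 < w x)%R by rewrite lt_neqAle eq_sym wx w0.
apply: normed_cvg.
(* Instead of a square root, |h| <= p + h^2 / p with p = (2/3)^n is used: h_n^2 <= (L / w) 2^-n
   turns the second term into (L / w) (3/4)^n, since (1/2) / (2/3) = 3/4. *)
apply: (@series_le_cvg _ _ (geometric (1 + L / w x)%R (3 / 4)%R)).
- by move=> n /=.
- move=> n; rewrite /geometric/= mulr_ge0// ?exprn_ge0// ?addr_ge0 ?divr_ge0//.
- move=> n; rewrite /geometric/=.
  have p0 : (0 < (2 / 3) ^+ n :> R)%R by rewrite exprn_gt0.
  have h1 : (h n x ^+ 2 <= L / w x * 2^-1 ^+ n)%R.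
    rewrite -(ler_pM2r wx0) -(@ler_pM2l _ (2 ^+ n)%R) ?exprn_gt0//.
    apply: le_trans (FL n) _; rewrite exprVn le_eqVlt; apply/orP; left; apply/eqP.
    by field; rewrite ?expf_neq0//= wx.
  have h2 : (`|h n x| <= (2 / 3) ^+ n + h n x ^+ 2 / (2 / 3) ^+ n)%R.
    rewrite -(real_normK (num_real (h n x))); move: (normr_ge0 (h n x)).
    move: (`|h n x|%R) ((2 / 3) ^+ n)%R p0 => y p p0 y0.
    have -> : (p + y ^+ 2 / p = y + ((p - y) ^+ 2 + p * y) / p)%R by field; rewrite gt_eqF.
    by rewrite lerDl divr_ge0// ?addr_ge0 ?sqr_ge0// ?mulr_ge0// ltW.
  apply: le_trans h2 _; rewrite [leRHS]mulrDl mul1r; apply: lerD.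
    by rewrite lerXn2r ?nnegrE//; lra.
  rewrite ler_pdivrMr// -mulrA -exprMn (_ : 3 / 4 * (2 / 3) = 2^-1 :> R)%R//.
  by field.
- apply: is_cvg_geometric_series; rewrite gtr0_norm; lra.
Qed.

Lemma Rintegral_linear (k : R) (f g : T -> R) :
  mu.-integrable D (EFin \o f) -> mu.-integrable D (EFin \o g) ->
  (\int[mu]_(x in D) (k * f x + g x) =
   k * \int[mu]_(x in D) f x + \int[mu]_(x in D) g x)%R.
Proof.
move=> fi gi; rewrite RintegralD// ?RintegralZl//.
by apply: eq_integrable (integrableZl mD k fi).
Qed.

Lemma EFin_Rintegral (f : T -> R) : mu.-integrable D (EFin \o f) ->
  (\int[mu]_(x in D) f x)%R%:E = \int[mu]_(x in D) (f x)%:E.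
Proof. by move=> fi; rewrite fineK//; exact: integrable_fin_num. Qed.

Section weighted.
Variable w : T -> R.
Hypotheses (mw : measurable_fun D w) (w0 : forall x, (0 <= w x)%R).

Definition sq_integrable (a : T -> R) :=
  mu.-integrable D (fun x => (a x ^+ 2 * w x)%:E).

(** Pointwise, |a b s| <= (a^2 + b^2) w. Every term of the weak form is estimated this way, with s a
    signed factor (kernel, kernel gap, alpha or 1) and w a weight dominating it. *)
Lemma sq_integrable_bound (a b s : T -> R) :
  measurable_fun D a -> measurable_fun D b -> measurable_fun D s ->
  (forall x, `|s x| <= w x)%R ->
  sq_integrable a -> sq_integrable b ->
  mu.-integrable D (fun x => (a x * b x * s x)%:E) /\
  (`|\int[mu]_(x in D) (a x * b x * s x)| <=
   \int[mu]_(x in D) (a x ^+ 2 * w x) + \int[mu]_(x in D) (b x ^+ 2 * w x))%R.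
Proof.
move=> ma mb ms sw ai bi.
have le x : (`|a x * b x * s x| <= a x ^+ 2 * w x + b x ^+ 2 * w x)%R.
  by rewrite !normrM -mulrDl ler_pM ?mulr_ge0 ?normM_le_sqrD.
have abi : mu.-integrable D (fun x => (a x * b x * s x)%:E).
  apply: le_integrable (integrableD mD ai bi) => //.
    by apply/measurable_EFinP; apply: measurable_funM => //; exact: measurable_funM.
  by move=> x _; rewrite /= lee_fin; apply: le_trans (le x) _; exact: ler_norm.
split => //; apply: le_trans (le_normr_Rintegral _ _) _ => //.
rewrite -RintegralD//; apply: le_Rintegral => //.
- exact: integrable_norm.
- by apply: eq_integrable (integrableD mD ai bi).
Qed.

Lemma sq_integrableM (a b : T -> R) :
  measurable_fun D a -> measurable_fun D b ->
  sq_integrable a -> sq_integrable b ->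
  mu.-integrable D (fun x => (a x * b x * w x)%:E).
Proof.
move=> ma mb ai bi.
have ww x : (`|w x| <= w x)%R by rewrite ger0_norm.
by have [] := sq_integrable_bound ma mb mw ww ai bi.
Qed.

Lemma sq_integrable_linear (k : R) (a b : T -> R) :
  measurable_fun D a -> measurable_fun D b ->
  sq_integrable a -> sq_integrable b ->
  sq_integrable (fun x => k * a x + b x)%R.
Proof.
move=> ma mb ai bi.
have abi := sq_integrableM ma mb ai bi.
apply: eq_integrable (integrableD mD (integrableZl mD (k ^+ 2)%R ai)
  (integrableD mD (integrableZl mD (2 * k)%R abi) bi)) => // x _ /=.
by rewrite -!EFinM -!EFinD; congr EFin; ring.
Qed.

End weighted.

End MeasureFacts.

(** * The energy space *)

Lemma bilinear_on_Rintegral (R : realType) (E : lmodType R) (V : set E)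
    d (X : measurableType d) (m : {measure set X -> \bar R}) (D : set X)
    (F : E -> E -> X -> R) : measurable D ->
  (forall u v, V u -> V v -> m.-integrable D (EFin \o F u v)) ->
  (forall k u v w x, F (k *: u + v) w x = k * F u w x + F v w x) ->
  (forall k u v w x, F w (k *: u + v) x = k * F w u x + F w v x) ->
  bilinear_on V (fun u v => \int[m]_(x in D) F u v x).
Proof.
move=> mD Fi FL FR; split=> w Vw k u v Vu Vv /=.
- by under eq_Rintegral do rewrite FL; rewrite Rintegral_linear//; exact: Fi.
- by under eq_Rintegral do rewrite FR; rewrite Rintegral_linear//; exact: Fi.
Qed.

Lemma bilinear_on_linear (R : realType) (E : lmodType R) (V : set E)
    (k : R) (s t : E -> E -> R) : bilinear_on V s -> bilinear_on V t ->
  bilinear_on V (fun u v => k * s u v + t u v).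
Proof.
move=> [sl sr] [tl tr]; split=> w Vw a u v Vu Vv /=.
- by rewrite (sl _ Vw a u v)// (tl _ Vw a u v)//; ring.
- by rewrite (sr _ Vw a u v)// (tr _ Vw a u v)//; ring.
Qed.

Section EnergySpace.
Context d (T : measurableType d) (R : realType).
Variable mu : {sigma_finite_measure set T -> \bar R}.
Variables (Om : set T) (w : T * T -> R).
Hypotheses (mOm : measurable Om) (mw : measurable_fun setT w).
Hypothesis w0 : forall z, 0 <= w z.

Local Notation mu2 := (mu \x mu)%E.

Definition increment (v : T -> R) (z : T * T) : R := v z.1 - v z.2.

Definition energy_space : set (T -> R) :=
  [set v | [/\ measurable_fun setT v, sq_integrable mu Om (cst 1) v &
    sq_integrable mu2 (Om `*` setT) w (increment v)]].

(** The factor 1 makes the L^2 part an instance of the weighted integrals, with weight [cst 1]. *)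
Definition energy_dot (u v : T -> R) : R :=
  \int[mu]_(x in Om) (u x * v x * 1) +
  \int[mu2]_(z in Om `*` setT) (increment u z * increment v z * w z).

Local Notation V := energy_space.
Local Notation q v := (energy_dot v v).

Let mOT : measurable (Om `*` [set: T]).
Proof. exact: measurableX. Qed.

Let m1 (A : set T) : measurable_fun A (cst 1 : T -> R).
Proof. exact: measurable_cst. Qed.

Let le01 (x : T) : 0 <= (cst 1 : T -> R) x. Proof. exact: ler01. Qed.

Let mwT (D : set (T * T)) : measurable_fun D w. Proof. exact: measurable_funTS. Qed.

Lemma measurable_increment (v : T -> R) (D : set (T * T)) :
  measurable_fun setT v -> measurable_fun D (increment v).
Proof.
move=> mv; apply: measurable_funTS.
by apply: measurable_funB; apply: measurableT_comp.
Qed.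

Lemma energy_space_linear a u v : V u -> V v -> V (a *: u + v).
Proof.
move=> [mu_ u1 u2] [mv v1 v2]; split.
- by apply: measurable_funD => //; exact: measurable_funM.
- exact: (@sq_integrable_linear _ T R mu Om mOm (cst 1) (@m1 Om) le01 a u v
    (measurable_funTS mu_) (measurable_funTS mv) u1 v1).
- have := @sq_integrable_linear _ _ R mu2 _ mOT w (@mwT _) w0 a _ _
    (measurable_increment mu_) (measurable_increment mv) u2 v2.
  congr (integrable _ _ _); apply/funext => z; congr ((_ ^+ 2 * _)%:E).
  by rewrite /increment /= !fctE /=; rewrite /GRing.scale/=; ring.
Qed.

Lemma energy_space0 : V 0.
Proof.
split; first exact: measurable_cst.
- apply: eq_integrable (integrable0 _ _) => // x _ /=.
  by rewrite expr0n mul0r.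
- apply: eq_integrable (integrable0 _ _) => // x _ /=.
  by rewrite /increment subrr expr0n mul0r.
Qed.

Lemma energy_integrable1 u v : V u -> V v ->
  mu.-integrable Om (fun x => (u x * v x * 1)%:E).
Proof.
move=> [mu_ u1 _] [mv v1 _].
exact: (@sq_integrableM _ T R mu Om mOm (cst 1) (@m1 Om) le01 u v
  (measurable_funTS mu_) (measurable_funTS mv) u1 v1).
Qed.

Lemma energy_integrable2 u v : V u -> V v ->
  mu2.-integrable (Om `*` setT)
    (fun z => (increment u z * increment v z * w z)%:E).
Proof.
move=> [mu_ _ u2] [mv _ v2].
exact: (@sq_integrableM _ _ R mu2 _ mOT w (@mwT _) w0 _ _
  (measurable_increment mu_) (measurable_increment mv) u2 v2).
Qed.

Lemma energy_dot_bilinear : bilinear_on V energy_dot.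
Proof.
have := @bilinear_on_linear R _ V 1 _ _ (@bilinear_on_Rintegral R _ V _ T mu Om
  (fun u v x => u x * v x * 1) mOm energy_integrable1 _ _)
  (@bilinear_on_Rintegral R _ V _ _ mu2 (Om `*` setT)
  (fun u v z => increment u z * increment v z * w z) mOT energy_integrable2 _ _).
have -> : energy_dot = (fun u v => 1 * \int[mu]_(x in Om) (u x * v x * 1) +
  \int[mu2]_(z in Om `*` setT) (increment u z * increment v z * w z)).
  by apply/funext => u; apply/funext => v; rewrite mul1r.
apply; move=> k u v x y; rewrite /increment !fctE /GRing.scale/=; ring.
Qed.

Lemma energy_dotC u v : energy_dot u v = energy_dot v u.
Proof.
by congr (_ + _); apply: eq_Rintegral => x _; rewrite [X in X * _]mulrC.
Qed.

Lemma energy_parts_ge0 v :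
  0 <= \int[mu]_(x in Om) (v x * v x * 1) /\
  0 <= \int[mu2]_(z in Om `*` setT) (increment v z * increment v z * w z).
Proof.
split; apply: Rintegral_ge0 => x _; rewrite -expr2 mulr_ge0 ?sqr_ge0//.
Qed.

Lemma energy_dot_ge0 v : 0 <= q v.
Proof. by have [? ?] := energy_parts_ge0 v; exact: addr_ge0. Qed.

Local Open Scope ereal_scope.

Lemma energy_part1_le v : V v ->
  \int[mu]_(x in Om) (v x ^+ 2 * 1)%:E <= (q v)%:E.
Proof.
move=> Vv; rewrite -EFin_Rintegral//; last by case: Vv.
by rewrite lee_fin lerDl; have [] := energy_parts_ge0 v.
Qed.

Lemma energy_part2_le v : V v ->
  \int[mu2]_(z in Om `*` setT) (increment v z ^+ 2 * w z)%:E <= (q v)%:E.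
Proof.
move=> Vv; rewrite -EFin_Rintegral//; last by case: Vv.
by rewrite lee_fin lerDr; have [] := energy_parts_ge0 v.
Qed.

Lemma energy_spaceP (v : T -> R) : measurable_fun setT v ->
  \int[mu]_(x in Om) (v x ^+ 2 * 1)%:E < +oo ->
  \int[mu2]_(z in Om `*` setT) (increment v z ^+ 2 * w z)%:E < +oo ->
  V v.
Proof.
move=> mv i1 i2; split => //; apply/integrableP; split.
- apply/measurable_EFinP/measurable_funM => //.
  by apply/measurable_funX/measurable_funTS.
- rewrite (eq_integral (fun x => (v x ^+ 2 * 1)%:E))// => x _.
  by rewrite gee0_abs// lee_fin mulr_ge0 ?sqr_ge0.
- apply/measurable_EFinP/measurable_funM => //.
  by apply: measurable_funX; exact: measurable_increment.
- rewrite (eq_integral (fun z => (increment v z ^+ 2 * w z)%:E))// => z _.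
  by rewrite gee0_abs// lee_fin mulr_ge0 ?sqr_ge0.
Qed.

Lemma series_diff_cvg (a : nat -> R) :
  cvgn (series (fun n => a n - a n.+1)%R) -> cvgn a.
Proof.
have -> : series (fun n => a n - a n.+1)%R = (fun n => a 0%N - a n)%R.
  apply/funext; elim=> [|n ih]; first by rewrite /series/= big_nil subrr.
  by rewrite seriesSr ih; ring.
move=> h; have -> : a = (fun n => a 0%N - (a 0%N - a n))%R.
  by apply/funext => n; ring.
by apply: is_cvgB => //; exact: is_cvg_cst.
Qed.

(* Along a fast Cauchy sequence the increments converge almost everywhere where
   w does not vanish, which gives convergence of the values outside Om exactly
   where the weight sees them. *)
Lemma energy_space_complete (u_ : nat -> T -> R) : (forall n, V (u_ n)) ->
  (forall n m, (n <= m)%N -> (q (u_ n - u_ m) <= 4^-1 ^+ n)%R) ->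
  exists2 u, V u & forall n, (q (u_ n - u) <= 2 * 4^-1 ^+ n)%R.
Proof.
move=> Vu cau.
have VB u v : V u -> V v -> V (u - v)%R.
  exact: (@subspaceB _ _ V energy_space_linear).
have mu_ n : measurable_fun setT (u_ n) by case: (Vu n).
(* The limit superior is measurable whether or not the sequence converges; [fine] gives it the value
   0 where it is infinite. *)
pose u x := fine (limn_esup (fun n => (u_ n x)%:E)).
have mu_u : measurable_fun setT u.
  apply: measurableT_comp => //; apply: measurable_fun_limn_esup => n.
  exact/measurable_EFinP.
have uE x : cvgn (u_ ^~ x) -> u_ n x @[n --> \oo] --> u x.
  move=> /cvg_ex[l ul]; suff -> : u x = l by [].
  rewrite /u; have El : (u_ n x)%:E @[n --> \oo] --> l%:E.
    by apply/cvg_EFin => //; exact: nearW.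
  by have [_ ->] := cvg_limn_einf_sup El.
have sh k x (l : R) : u_ n x @[n --> \oo] --> l -> u_ (n + k)%N x @[n --> \oo] --> l.
  by move=> h; rewrite (cvg_shiftn k (u_ ^~ x)).
have ae1 : {ae mu, forall x, Om x -> cvgn (u_ ^~ x)}.
  have h := fun a => @ae_cvg_series_fast _ T R mu Om mOm
    (fun n => u_ n - u_ n.+1)%R (cst 1%R) a (@m1 Om) le01.
  apply: filterS (h _ _) => [x /= h1 Ox|n|n].
  - by apply: series_diff_cvg; apply: h1 => //; exact: oner_neq0.
  - by apply: measurable_funTS; exact: measurable_funB.
  - apply: le_trans (energy_part1_le (VB _ _ (Vu n) (Vu n.+1))) _.
    by rewrite lee_fin cau.
have ae2 : {ae mu2, forall z, (Om `*` setT) z -> w z != 0%R ->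
    cvgn (fun n => increment (u_ n) z)}.
  have h := fun a => @ae_cvg_series_fast _ _ R mu2 (Om `*` setT) mOT
    (fun n => increment (u_ n - u_ n.+1)%R) w a (@mwT _) w0.
  apply: filterS (h _ _) => [z /= h1 Oz wz|n|n].
  - have E : (fun n => increment (u_ n - u_ n.+1)%R z) =
        (fun n => increment (u_ n) z - increment (u_ n.+1) z)%R.
      by apply/funext => n; rewrite /increment !fctE/=; ring.
    by apply: series_diff_cvg; have := h1 Oz wz; rewrite E.
  - exact: (@measurable_increment (u_ n - u_ n.+1)%R _ (measurable_funB (mu_ n) (mu_ n.+1))).
  - apply: le_trans (energy_part2_le (VB _ _ (Vu n) (Vu n.+1))) _.
    by rewrite lee_fin cau.
have lim1 n : \int[mu]_(x in Om) ((u_ n - u)%R x ^+ 2 * 1)%:E <= (4^-1 ^+ n)%:E.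
  apply: (@ae_cvg_le_integral _ T R mu Om mOm
    (fun m x => (u_ n - u_ (m + n)%N)%R x ^+ 2 * 1)%R).
  - move=> m; apply: measurable_funTS; apply: measurable_funM => //.
    by apply: measurable_funX; exact: measurable_funB.
  - apply: measurable_funTS; apply: measurable_funM => //.
    by apply: measurable_funX; exact: measurable_funB.
  - by move=> m x; rewrite mulr1 sqr_ge0.
  - apply: filterS ae1 => x h Ox; have {}h := uE _ (h Ox).
    under eq_fun do rewrite mulr1; rewrite mulr1 !fctE/=.
    apply: (@cvg_comp _ _ _ _ (fun y => y ^+ 2)%R); last exact: exprn_continuous.
    by apply: cvgB; [exact: cvg_cst|exact: sh].
  - move=> m; apply: le_trans (energy_part1_le (VB _ _ (Vu n) (Vu _))) _.
    by rewrite lee_fin cau// leq_addl.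
have lim2 n : \int[mu2]_(z in Om `*` setT)
    (increment (u_ n - u)%R z ^+ 2 * w z)%:E <= (4^-1 ^+ n)%:E.
  apply: (@ae_cvg_le_integral _ _ R mu2 _ mOT
    (fun m z => increment (u_ n - u_ (m + n)%N)%R z ^+ 2 * w z)%R).
  - move=> m; apply: measurable_funM => //.
    by apply: measurable_funX; apply: measurable_increment; exact: measurable_funB.
  - apply: measurable_funM => //.
    by apply: measurable_funX; apply: measurable_increment; exact: measurable_funB.
  - by move=> m x; rewrite mulr_ge0 ?sqr_ge0.
  - apply: filterS2 (ae_fst ae1) ae2 => z h1 h2 Oz.
    (* Where the weight vanishes so does the integrand, and nothing need be known about u_n at z.2.
       Elsewhere u_n(z.2) is u_n(z.1) minus the increment, and both converge. *)
    have [->|wz] := eqVneq (w z) 0%R.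
      by under eq_fun do rewrite mulr0; rewrite mulr0; exact: cvg_cst.
    have c1 := h1 Oz.1; have c2 : cvgn (u_ ^~ z.2).
      have -> : u_ ^~ z.2 = (fun m => u_ m z.1 - increment (u_ m) z)%R.
        by apply/funext => m; rewrite /increment/=; ring.
      exact: is_cvgB c1 (h2 Oz wz).
    apply: cvgM; last exact: cvg_cst.
    apply: (@cvg_comp _ _ _ _ (fun y => y ^+ 2)%R); last exact: exprn_continuous.
    apply: cvgB; (apply: cvgB; [exact: cvg_cst|exact/sh/uE]).
  - move=> m; apply: le_trans (energy_part2_le (VB _ _ (Vu n) (Vu _))) _.
    by rewrite lee_fin cau// leq_addl.
have Vd n : V (u_ n - u)%R.
  apply: energy_spaceP; first exact: measurable_funB.
  - by apply: le_lt_trans (lim1 n) _; exact: ltry.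
  - by apply: le_lt_trans (lim2 n) _; exact: ltry.
exists u.
  by have := VB _ _ (Vu 0%N) (Vd 0%N); rewrite subKr.
move=> n; rewrite mulr_natl mulr2n; apply: lerD; rewrite -lee_fin EFin_Rintegral//.
- exact: lim1.
- exact: (energy_integrable1 (Vd n) (Vd n)).
- exact: lim2.
- exact: (energy_integrable2 (Vd n) (Vd n)).
Qed.

End EnergySpace.

(** * The weak form for a product-measurable kernel *)

Section KernelForm.
Context d (T : measurableType d) (R : realType).
Variable mu : {sigma_finite_measure set T -> \bar R}.
Variables (Om : set T) (K : T * T -> R).
Hypotheses (mOm : measurable Om) (mK : measurable_fun setT K).
Hypothesis K0 : forall z, 0 <= K z.

Local Notation mu2 := (mu \x mu)%E.

(** At (x, y) the norm of V weights the squared increment by the kernel at (y, x), so the transpose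
    is the weight of the energy space. *)
Let Kt (z : T * T) : R := K (z.2, z.1).
Let gap (z : T * T) : R := K z - Kt z.
Let agap (z : T * T) : R := `|gap z|.

Let mKt : measurable_fun setT Kt.
Proof. by apply: measurableT_comp => //; exact: measurable_swap. Qed.

Let Kt0 z : 0 <= Kt z. Proof. exact: K0. Qed.

Let mgap : measurable_fun setT gap.
Proof. exact: measurable_funB. Qed.

Let magap : measurable_fun setT agap.
Proof. exact: measurableT_comp. Qed.

Let agap0 z : 0 <= agap z. Proof. exact: normr_ge0. Qed.

Local Notation V := (energy_space mu Om Kt).
Local Notation q v := (energy_dot mu Om Kt v v).

Definition kernel_form_integrand (u v : T -> R) (z : T * T) : R :=
  (u z.1 * K z - u z.2 * Kt z) * (v z.1 - v z.2).

Definition kernel_form (S : set T) (u v : T -> R) : R :=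
  \int[mu2]_(z in Om `*` S) kernel_form_integrand u v z.

Let integrandE u v z : kernel_form_integrand u v z =
  increment u z * increment v z * Kt z + u z.1 * increment v z * gap z.
Proof. by rewrite /kernel_form_integrand /increment /gap; ring. Qed.

(** * Estimates over Om x S, for S the domain or the nonlocal boundary *)

Section Estimates.
Variables (S : set T) (M : R).
Hypotheses (mS : measurable S) (M0 : 0 <= M).
Hypothesis gapM : {ae mu, forall x, Om x ->
  (\int[mu]_(y in S) (agap (x, y))%:E <= M%:E)%E}.

Let mOS : measurable (Om `*` S). Proof. exact: measurableX. Qed.

Let subOS : Om `*` S `<=` Om `*` setT. Proof. by move=> z []. Qed.

Let mfst (u : T -> R) (D : set (T * T)) : measurable_fun setT u ->
  measurable_fun D (fun z => u z.1).
Proof. by move=> mu_; apply: measurable_funTS; exact: measurableT_comp. Qed.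

Let msection (f : T * T -> R) x (D : set T) : measurable_fun setT f ->
  measurable_fun D (fun y => f (x, y)).
Proof. by move=> mf; apply: measurable_funTS; exact: measurable_fun_pair2. Qed.

(** Integrating in y first leaves u(x)^2 times a slice integral that [gapM] bounds by M, so the L^2
    part of the energy suffices. *)
Lemma fst_sq_integrable u : V u ->
  sq_integrable mu2 (Om `*` S) agap (fun z => u z.1) /\
  \int[mu2]_(z in Om `*` S) (u z.1 ^+ 2 * agap z) <= M * q u.
Proof.
move=> Vu; have [mu_ u1 _] := Vu.
have mf : measurable_fun setT (fun z : T * T => (u z.1 ^+ 2 * agap z)%:E).
  apply/measurable_EFinP/measurable_funM => //.
  by apply: measurable_funX; exact: mfst.
have f0 (z : T * T) : (0 <= (u z.1 ^+ 2 * agap z)%:E)%E.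
  by rewrite lee_fin mulr_ge0 ?sqr_ge0.
have le : (\int[mu2]_(z in Om `*` S) (u z.1 ^+ 2 * agap z)%:E <=
    (M * q u)%:E)%E.
  rewrite tonelli_setX1// EFinM.
  apply: (@le_trans _ _ (M%:E * \int[mu]_(x in Om) (u x ^+ 2 * 1)%:E)%E); last first.
    by rewrite lee_wpmul2l ?lee_fin//; exact: energy_part1_le.
  rewrite -ge0_integralZl_EFin//; last 2 first.
  - by move=> x _; rewrite lee_fin mulr1 sqr_ge0.
  - exact: measurable_int u1.
  apply: ae_ge0_le_integral => //.
  - by move=> x _; apply: integral_ge0 => y _; exact: f0.
  - exact: (measurable_tonelli1 mu mOm mS mf f0).
  - by move=> x _; rewrite mule_ge0 ?lee_fin// mulr1 sqr_ge0.
  - by apply: measurable_funeM; exact: measurable_int u1.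
  apply: filterS gapM => x gM Ox; have {}gM := gM Ox => /=.
  under eq_integral do rewrite EFinM.
  rewrite ge0_integralZl_EFin ?sqr_ge0//; last 2 first.
  - by move=> y _; rewrite lee_fin.
  - by apply/measurable_EFinP; exact: msection.
  by rewrite mulr1 muleC lee_wpmul2r// lee_fin sqr_ge0.
have i1 : sq_integrable mu2 (Om `*` S) agap (fun z => u z.1).
  apply/integrableP; split; first exact: measurable_funTS.
  rewrite (eq_integral (fun z => (u z.1 ^+ 2 * agap z)%:E)).
    by apply: le_lt_trans le _; exact: ltry.
  by move=> z _; rewrite gee0_abs.
by split => //; rewrite -lee_fin EFin_Rintegral.
Qed.

(* [fine] is harmless: the slice integral is finite for almost every x in Om. *)
Lemma fst_sq_fubini u (s : T * T -> R) : V u -> measurable_fun setT s ->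
  (forall z, `|s z| <= agap z) ->
  let a x := fine (\int[mu]_(y in S) (s (x, y))%:E) in
  [/\ mu2.-integrable (Om `*` S) (fun z => (u z.1 ^+ 2 * s z)%:E),
      mu.-integrable Om (fun x => (u x ^+ 2 * a x)%:E) &
      \int[mu2]_(z in Om `*` S) (u z.1 ^+ 2 * s z) =
      \int[mu]_(x in Om) (u x ^+ 2 * a x)].
Proof.
move=> Vu ms sg a; have [mu_ _ _] := Vu; have [i1 _] := fst_sq_integrable Vu.
have i2 : mu2.-integrable (Om `*` S) (fun z => (u z.1 ^+ 2 * s z)%:E).
  apply: le_integrable i1 => //.
    apply/measurable_EFinP/measurable_funM; last exact: measurable_funTS.
    by apply: measurable_funX; exact: mfst.
  move=> z _; rewrite lee_fin !normrM (ger0_norm (agap0 z)) ler_wpM2l//.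
have i3 := integrable_fubini1 mOm mS i2.
have ma : measurable_fun Om (fun x => (u x ^+ 2 * a x)%:E).
  apply/measurable_EFinP/measurable_funM.
    by apply/measurable_funX/measurable_funTS.
  apply: measurableT_comp => //.
  by apply: (@measurable_integral_setX1 _ _ _ _ _ _ (EFin \o s)) => //; exact/measurable_EFinP.
have ae : {ae mu, forall x, Om x ->
    (\int[mu]_(y in S) (u x ^+ 2 * s (x, y))%:E = (u x ^+ 2 * a x)%:E)%E}.
  apply: filterS gapM => x gM Ox; have {}gM := gM Ox.
  have si : mu.-integrable S (fun y => (s (x, y))%:E).
    apply/integrableP; split; first by apply/measurable_EFinP; exact: msection.
    apply: le_lt_trans (ltry M); apply: le_trans gM.
    apply: ge0_le_integral => //.
    - by apply: measurableT_comp => //; apply/measurable_EFinP; exact: msection.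
    - by apply/measurable_EFinP; exact: msection.
    - by move=> y _; rewrite lee_fin.
  rewrite EFinM fineK; last exact: integrable_fin_num.
  by rewrite -integralZl//; apply: eq_integral => y _; rewrite EFinM.
have i4 : mu.-integrable Om (fun x => (u x ^+ 2 * a x)%:E).
  apply/integrableP; split => //.
  move/integrableP : i3 => [mi3]; congr (_ < +oo)%E.
  apply: ae_eq_integral => //; [exact: measurableT_comp..|].
  by apply: filterS ae => x h Ox /=; rewrite h.
split => //; apply: EFin_inj; rewrite EFin_Rintegral// fubini_setX1//.
rewrite [RHS]EFin_Rintegral//; apply: ae_eq_integral => //.
exact: measurable_int i3.
Qed.

Variable C' : R.
Hypothesis C'0 : 0 <= C'.
(** For S = Om this will hold with C' = 2 by symmetry, for S = W with C' = C + 1 by domination of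
    the kernel. *)
Hypothesis gapC : forall v, V v ->
  (\int[mu2]_(z in Om `*` S) (increment v z ^+ 2 * agap z)%:E <= (C' * q v)%:E)%E.

Let gap_sq_integrable v : V v -> sq_integrable mu2 (Om `*` S) agap (increment v).
Proof.
move=> Vv; have [mv _ _] := Vv; apply/integrableP; split.
  apply/measurable_EFinP/measurable_funM; last exact: measurable_funTS.
  by apply: measurable_funX; exact: measurable_increment.
rewrite (eq_integral (fun z => (increment v z ^+ 2 * agap z)%:E)).
  by apply: le_lt_trans (gapC Vv) _; exact: ltry.
by move=> z _; rewrite gee0_abs// lee_fin mulr_ge0 ?sqr_ge0.
Qed.

Let cross_term u v : V u -> V v ->
  mu2.-integrable (Om `*` S) (fun z => (u z.1 * increment v z * gap z)%:E) /\
  `|\int[mu2]_(z in Om `*` S) (u z.1 * increment v z * gap z)| <=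
    M * q u + C' * q v.
Proof.
move=> Vu Vv; have [mu_ _ _] := Vu; have [mv _ _] := Vv.
have [u1 uM] := fst_sq_integrable Vu; have v1 := gap_sq_integrable Vv.
have [] := @sq_integrable_bound _ _ R mu2 _ mOS agap
  (fun z => u z.1) (increment v) gap (mfst mu_) (measurable_increment mv)
  (measurable_funTS mgap) (fun z => lexx _) u1 v1.
move=> i1 h; split => //; apply: le_trans h _; apply: lerD => //.
by rewrite -lee_fin EFin_Rintegral//; exact: gapC.
Qed.

Let sub_sq_integrable v : V v -> sq_integrable mu2 (Om `*` S) Kt (increment v).
Proof. by case=> _ _; apply: integrableS => //; exact: measurableX. Qed.

Let sub_energy v : V v ->
  \int[mu2]_(z in Om `*` S) (increment v z ^+ 2 * Kt z) <= q v.
Proof.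
move=> Vv; rewrite -lee_fin EFin_Rintegral//; last exact: sub_sq_integrable.
apply: le_trans (energy_part2_le mOm Kt0 Vv); apply: ge0_subset_integral => //.
- exact: measurableX.
- by have [_ _ /measurable_int] := Vv.
- by move=> z _; rewrite lee_fin mulr_ge0 ?sqr_ge0.
Qed.

Let main_term u v : V u -> V v ->
  mu2.-integrable (Om `*` S) (fun z => (increment u z * increment v z * Kt z)%:E) /\
  `|\int[mu2]_(z in Om `*` S) (increment u z * increment v z * Kt z)| <= q u + q v.
Proof.
move=> Vu Vv; have [mu_ _ _] := Vu; have [mv _ _] := Vv.
have [|i1 h] := @sq_integrable_bound _ _ R mu2 _ mOS Kt
  (increment u) (increment v) Kt (measurable_increment mu_) (measurable_increment mv)
  (measurable_funTS mKt) _ (sub_sq_integrable Vu) (sub_sq_integrable Vv).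
  by move=> z; rewrite ger0_norm.
by split => //; apply: le_trans h _; apply: lerD; exact: sub_energy.
Qed.

Lemma kernel_form_integrable u v : V u -> V v ->
  mu2.-integrable (Om `*` S) (fun z => (kernel_form_integrand u v z)%:E).
Proof.
move=> Vu Vv; have [i1 _] := main_term Vu Vv; have [i2 _] := cross_term Vu Vv.
apply: eq_integrable (integrableD mOS i1 i2) => // z _ /=.
by rewrite integrandE EFinD.
Qed.

Lemma kernel_form_bound u v : V u -> V v ->
  `|kernel_form S u v| <= (1 + M + C') * (q u + q v).
Proof.
move=> Vu Vv; have [i1 h1] := main_term Vu Vv; have [i2 h2] := cross_term Vu Vv.
rewrite /kernel_form; under eq_Rintegral do rewrite integrandE.
rewrite RintegralD//; apply: le_trans (ler_normD _ _) _.
apply: le_trans (lerD h1 h2) _.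
have qu : 0 <= q u by exact: energy_dot_ge0.
have qv : 0 <= q v by exact: energy_dot_ge0.
have := mulr_ge0 M0 qv; have := mulr_ge0 C'0 qu.
lra.
Qed.

Lemma kernel_form_bilinear : bilinear_on V (kernel_form S).
Proof.
apply: bilinear_on_Rintegral => //; first exact: kernel_form_integrable.
- move=> k u v w z; rewrite /kernel_form_integrand !fctE /GRing.scale/=; ring.
- move=> k u v w z; rewrite /kernel_form_integrand !fctE /GRing.scale/=; ring.
Qed.

(** The factor u(y) has no direct control against the gap; writing it as u(x) - (u(x) - u(y)) leaves
    two terms already known to be integrable. *)
Lemma kernel_form_diag_integrable u : V u ->
  mu2.-integrable (Om `*` S) (fun z => (u z.1 * u z.2 * gap z)%:E).
Proof.
move=> Vu; have [i1 _] := cross_term Vu Vu.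
have [i2 _ _] := fst_sq_fubini Vu mgap (fun z => lexx _).
apply: eq_integrable (integrableB mOS i2 i1) => // z _ /=.
by rewrite -EFinB; congr EFin; rewrite /increment; ring.
Qed.

(* u(x) u(y) (K(x,y) - K(y,x)) is antisymmetric, hence its integral over
   Om x Om vanishes. *)
Lemma kernel_form_diag_sym u : V u -> S = Om ->
  kernel_form S u u = \int[mu2]_(z in Om `*` S) (increment u z ^+ 2 * Kt z) +
    \int[mu2]_(z in Om `*` S) (u z.1 ^+ 2 * gap z).
Proof.
move=> Vu SO; have i0 := kernel_form_diag_integrable Vu.
have [i1 _] := main_term Vu Vu.
have [i2 _ _] := fst_sq_fubini Vu mgap (fun z => lexx _).
have i3 := sub_sq_integrable Vu.
have anti : \int[mu2]_(z in Om `*` S) (u z.1 * u z.2 * gap z) = 0.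
  have i4 := integrableZl mOS (-1) i0; subst S.
  set I := LHS; suff : I = -1 * I by move=> ?; lra.
  rewrite -RintegralZl//; congr fine.
  (* Opposite orders of integration on the two sides exchange x and y, which flips the sign of the
     gap. *)
  rewrite fubini_setX2// fubini_setX1//.
  apply: eq_integral => x _; apply: eq_integral => y _ /=; congr EFin.
  by rewrite /gap /Kt/=; ring.
rewrite -[RHS]subr0 -[X in _ - X]anti -RintegralD// -RintegralB//; last first.
  by apply: eq_integrable (integrableD mOS i3 i2).
by apply: eq_Rintegral => z _; rewrite integrandE /increment; ring.
Qed.

(** Young's inequality with weight k: the cross term is at least -|gap| (k/2 u(x)^2 + b^2 / (2k)),
    with b the increment. As |gap| <= k Kt, the b^2 part costs at most half of b^2 Kt. The value k =
    C + 1 is the source of (C + 1)/2 in the bound on alpha. *)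
Lemma kernel_form_diag_ge u (k : R) : V u -> 0 < k ->
  {ae mu2, forall z, (Om `*` S) z -> agap z <= k * Kt z} ->
  2^-1 * \int[mu2]_(z in Om `*` S) (increment u z ^+ 2 * Kt z) -
    k / 2 * \int[mu2]_(z in Om `*` S) (u z.1 ^+ 2 * agap z) <= kernel_form S u u.
Proof.
move=> Vu k0 gapk; have i3 := sub_sq_integrable Vu.
have [i2 _] := fst_sq_integrable Vu.
have [i1 _] := main_term Vu Vu; have [i4 _] := cross_term Vu Vu.
have j1 := integrableZl mOS (2^-1) i3.
have j2 := integrableZl mOS (k / 2) i2.
have i5 := kernel_form_integrable Vu Vu.
rewrite -!RintegralZl// -RintegralB// -subr_ge0 -RintegralB//; last first.
  by apply: eq_integrable (integrableB mOS j1 j2).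
apply: ae_Rintegral_ge0 => //.
  by apply: eq_integrable (integrableB mOS i5 (integrableB mOS j1 j2)).
apply: filterS gapk => z h Oz; have {h}gz := h Oz.
rewrite integrandE -/(increment u z).
move: (agap0 z) gz; rewrite /agap => g0.
move=> gk; have /andP[g1 g2] : - `|gap z| <= gap z <= `|gap z| by rewrite -ler_norml.
move: (increment u z) (u z.1) (Kt z) (gap z) (`|gap z|) g0 g1 g2 gk (Kt0 z).
move=> b a c g n n0 g1 g2 gk c0.
have k1 : 0 < k^-1 by rewrite invr_gt0.
have h1 : a * b * g >= - (n * (k / 2 * a ^+ 2 + (2 * k)^-1 * b ^+ 2)).
  (* Both n + g and n - g are nonnegative, so the two weighted squares give the inequality for
     either sign of g. *)
  have e1 : 0 <= (n + g) * (k * a + b) ^+ 2 / k.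
    by rewrite mulr_ge0 ?(ltW k1)// mulr_ge0 ?sqr_ge0//; lra.
  have e2 : 0 <= (n - g) * (k * a - b) ^+ 2 / k.
    by rewrite mulr_ge0 ?(ltW k1)// mulr_ge0 ?sqr_ge0//; lra.
  have e3 : (n + g) * (k * a + b) ^+ 2 / k + (n - g) * (k * a - b) ^+ 2 / k =
    4 * (n * (k / 2 * a ^+ 2 + (2 * k)^-1 * b ^+ 2) + a * b * g).
    by field; rewrite gt_eqF.
  by have := addr_ge0 e1 e2; rewrite e3; lra.
have h2 : n * ((2 * k)^-1 * b ^+ 2) <= 2^-1 * (b ^+ 2 * c).
  have -> : 2^-1 * (b ^+ 2 * c) = k * c * ((2 * k)^-1 * b ^+ 2).
    by field; rewrite gt_eqF.
  by rewrite ler_wpM2r// mulr_ge0 ?sqr_ge0// invr_ge0; lra.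
move: h1; rewrite mulrDr => h1.
have -> : b * b * c = b ^+ 2 * c by rewrite expr2.
have -> : k / 2 * (a ^+ 2 * n) = n * (k / 2 * a ^+ 2) by ring.
lra.
Qed.

End Estimates.

End KernelForm.

(** * Coercivity and existence for a product-measurable kernel *)

Section WeakSolution.
Context d (T : measurableType d) (R : realType).
Variable mu : {sigma_finite_measure set T -> \bar R}.
Variables (Om W : set T) (K : T * T -> R) (alpha f : T -> R) (M C c : R).
Hypotheses (mOm : measurable Om) (mW : measurable W) (OmW : Om `&` W = set0).
Hypotheses (mK : measurable_fun setT K) (K0 : forall z, 0 <= K z).
Hypotheses (malpha : measurable_fun setT alpha) (mf : measurable_fun setT f).
Hypotheses (M0 : 0 <= M) (C0 : 0 < C) (c0 : 0 < c).

Local Notation mu2 := (mu \x mu)%E.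

Let Kt (z : T * T) : R := K (z.2, z.1).
Let gap (z : T * T) : R := K z - Kt z.
Let agap (z : T * T) : R := `|gap z|.

Hypothesis gapOm : {ae mu, forall x, Om x ->
  (\int[mu]_(y in Om) (agap (x, y))%:E <= M%:E)%E}.
Hypothesis gapW : {ae mu, forall x, Om x ->
  (\int[mu]_(y in W) (agap (x, y))%:E <= M%:E)%E}.
Hypothesis K_le : {ae mu2, forall z, Om z.1 -> W z.2 -> K z <= C * Kt z}.
Hypothesis K_out : {ae mu2, forall z, Om z.1 -> ~ Om z.2 -> ~ W z.2 -> Kt z = 0}.
Hypothesis alphaM : {ae mu, forall x, Om x -> `|alpha x| <= M}.
Hypothesis f_L2 : sq_integrable mu Om (cst 1) f.
Hypothesis alpha_lb : {ae mu, forall x, Om x ->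
  (c%:E < (alpha x)%:E + 2^-1%:E * \int[mu]_(y in Om) (gap (x, y))%:E
    - ((C + 1) / 2)%:E * \int[mu]_(y in W) (agap (x, y))%:E)%E}.

Let mKt : measurable_fun setT Kt.
Proof. by apply: measurableT_comp => //; exact: measurable_swap. Qed.

Let Kt0 z : 0 <= Kt z. Proof. exact: K0. Qed.

Let mgap : measurable_fun setT gap.
Proof. exact: measurable_funB. Qed.

Let magap : measurable_fun setT agap.
Proof. exact: measurableT_comp. Qed.

Let agap0 z : 0 <= agap z. Proof. exact: normr_ge0. Qed.

Local Notation V := (energy_space mu Om Kt).
Local Notation q v := (energy_dot mu Om Kt v v).

Let q0 v : 0 <= q v. Proof. exact: energy_dot_ge0. Qed.

Let C10 : 0 < C + 1. Proof. by rewrite addr_gt0. Qed.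

Let mOS (S : set T) : measurable S -> measurable (Om `*` S).
Proof. exact: measurableX. Qed.

Let minc2 (w : T * T -> R) (v : T -> R) (D : set (T * T)) : measurable_fun setT w ->
  measurable_fun setT v -> measurable_fun D (fun z => (increment v z ^+ 2 * w z)%:E).
Proof.
move=> mw mv; apply/measurable_EFinP/measurable_funM; last exact: measurable_funTS.
by apply: measurable_funX; exact: measurable_increment.
Qed.

Let inc20 (w : T * T -> R) (v : T -> R) z : 0 <= w z ->
  (0 <= (increment v z ^+ 2 * w z)%:E)%E.
Proof. by move=> w0; rewrite lee_fin mulr_ge0 ?sqr_ge0. Qed.

Let sub_energy (S : set T) v : measurable S -> V v ->
  (\int[mu2]_(z in Om `*` S) (increment v z ^+ 2 * Kt z)%:E <= (q v)%:E)%E.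
Proof.
move=> mS Vv; have [mv _ _] := Vv.
apply: le_trans (energy_part2_le mOm Kt0 Vv); apply: ge0_subset_integral.
- exact: mOS.
- exact: mOS.
- exact: minc2.
- by move=> z _; exact: inc20.
- by move=> z [].
Qed.

(** On Om x Om no comparison of K with its transpose is assumed. But |K - Kt| <= K + Kt, and the
    squared increment is symmetric, so exchanging x and y turns the integral against K into the one
    against Kt. *)
Let gap_energyOm v : V v ->
  (\int[mu2]_(z in Om `*` Om) (increment v z ^+ 2 * agap z)%:E <= (2 * q v)%:E)%E.
Proof.
move=> Vv; have [mv _ _] := Vv.
have swapE : (\int[mu2]_(z in Om `*` Om) (increment v z ^+ 2 * K z)%:E =
    \int[mu2]_(z in Om `*` Om) (increment v z ^+ 2 * Kt z)%:E)%E.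
  rewrite (@tonelli_setX1 _ _ _ mu _ _ _ mOm mOm (minc2 mK mv)); last first.
    by move=> z; exact: inc20.
  rewrite (@tonelli_setX2 _ _ _ mu _ _ _ mOm mOm (minc2 mKt mv)); last first.
    by move=> z; exact: inc20.
  apply: eq_integral => x _; apply: eq_integral => y _ /=; congr EFin.
  by rewrite /increment /Kt/=; ring.
have mOO := mOS mOm.
apply: (@le_trans _ _ (\int[mu2]_(z in Om `*` Om)
  ((increment v z ^+ 2 * K z)%:E + (increment v z ^+ 2 * Kt z)%:E))%E).
  apply: ge0_le_integral => //.
  - by move=> z _; exact: inc20.
  - exact: minc2.
  - by apply: emeasurable_funD; exact: minc2.
  - move=> z _; rewrite -EFinD lee_fin -mulrDr ler_wpM2l ?sqr_ge0//.
    by apply: le_trans (ler_normB _ _) _; rewrite !ger0_norm.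
rewrite ge0_integralD//; try exact: minc2; try (move=> z _; exact: inc20).
by rewrite swapE mulr2n mulrDl mul1r EFinD; apply: leeD; exact: sub_energy.
Qed.

Let agap_le : {ae mu2, forall z, (Om `*` W) z -> agap z <= (C + 1) * Kt z}.
Proof.
apply: filterS K_le => z h [Oz Wz]; have {}h := h Oz Wz.
have := Kt0 z; have := K0 z; rewrite /agap /gap ler_norml => k1 k2.
by have := mulr_ge0 (ltW C0) k2; rewrite mulrDl mul1r; lra.
Qed.

Let gap_energyW v : V v ->
  (\int[mu2]_(z in Om `*` W) (increment v z ^+ 2 * agap z)%:E <=
    ((C + 1) * q v)%:E)%E.
Proof.
move=> Vv; have [mv _ _] := Vv; have mOW := mOS mW.
apply: (@le_trans _ _ ((C + 1)%:E *
  \int[mu2]_(z in Om `*` W) (increment v z ^+ 2 * Kt z)%:E)%E); last first.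
  by rewrite EFinM lee_wpmul2l ?lee_fin ?(ltW C10)//; exact: sub_energy.
rewrite -ge0_integralZl_EFin ?(ltW C10)//; last 2 first.
- by move=> z _; exact: inc20.
- exact: minc2.
apply: ae_ge0_le_integral => //.
- by move=> z _; exact: inc20.
- exact: minc2.
- by move=> z _; rewrite mule_ge0 ?inc20// lee_fin (ltW C10).
- by apply: measurable_funeM; exact: minc2.
apply: filterS agap_le => z h Oz; rewrite -EFinM lee_fin mulrCA ler_wpM2l ?sqr_ge0//.
exact: h.
Qed.

Let alpha_form (u v : T -> R) := \int[mu]_(x in Om) (u x * v x * alpha x).

Let alpha_form_estimate u v : V u -> V v ->
  mu.-integrable Om (fun x => (u x * v x * alpha x)%:E) /\
  `|alpha_form u v| <= M * (q u + q v).
Proof.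
move=> Vu Vv; pose w x := `|alpha x|.
have mw : measurable_fun Om w.
  by apply: measurableT_comp => //; exact: measurable_funTS.
have w0 x : 0 <= w x by exact: normr_ge0.
have sq v' : V v' -> sq_integrable mu Om w v' /\
    \int[mu]_(x in Om) (v' x ^+ 2 * w x) <= M * q v'.
  move=> Vv'; have [mv' v1 _] := Vv'.
  have m2 : measurable_fun Om (fun x => (v' x ^+ 2 * w x)%:E).
    apply/measurable_EFinP/measurable_funM => //.
    by apply/measurable_funX/measurable_funTS.
  have p0 x : (0 <= (v' x ^+ 2 * w x)%:E)%E by rewrite lee_fin mulr_ge0 ?sqr_ge0.
  have le : (\int[mu]_(x in Om) (v' x ^+ 2 * w x)%:E <= (M * q v')%:E)%E.
    apply: (@le_trans _ _ (M%:E * \int[mu]_(x in Om) (v' x ^+ 2 * 1)%:E)%E); last first.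
      by rewrite EFinM lee_wpmul2l ?lee_fin//; exact: energy_part1_le.
    rewrite -ge0_integralZl_EFin//; last 2 first.
    - by move=> x _; rewrite lee_fin mulr1 sqr_ge0.
    - exact: measurable_int v1.
    apply: ae_ge0_le_integral => //.
    - by move=> x _; rewrite mule_ge0 ?lee_fin// mulr1 sqr_ge0.
    - by apply: measurable_funeM; exact: measurable_int v1.
    apply: filterS alphaM => x h Ox; rewrite -EFinM lee_fin mulr1 mulrC.
    by rewrite ler_wpM2r ?sqr_ge0//; exact: h.
  have i1 : sq_integrable mu Om w v'.
    apply/integrableP; split => //.
    rewrite (eq_integral (fun x => (v' x ^+ 2 * w x)%:E)).
      by apply: le_lt_trans le _; exact: ltry.
    by move=> x _; rewrite gee0_abs.
  by split => //; rewrite -lee_fin EFin_Rintegral.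
have [mu_ _ _] := Vu; have [mv _ _] := Vv.
have [u1 u2] := sq _ Vu; have [v1 v2] := sq _ Vv.
have [i1 h] := @sq_integrable_bound _ _ R mu _ mOm w u v alpha
  (measurable_funTS mu_) (measurable_funTS mv) (measurable_funTS malpha)
  (fun x => lexx _) u1 v1.
by split => //; apply: le_trans h _; rewrite mulrDr; exact: lerD.
Qed.

Let source (v : T -> R) := \int[mu]_(x in Om) (f x * v x).

Let source_estimate v : V v ->
  mu.-integrable Om (fun x => (f x * v x)%:E) /\
  `|source v| <= (1 + \int[mu]_(x in Om) (f x ^+ 2 * 1)) * (1 + q v).
Proof.
move=> Vv; have [mv v1 _] := Vv.
have [|i1 h] := @sq_integrable_bound _ _ R mu _ mOm (cst 1) f v (cst 1) (measurable_funTS mf) (measurable_funTS mv)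
  (measurable_cst _) _ f_L2 v1.
  by move=> x; rewrite normr1.
split; first by apply: eq_integrable i1 => // x _; rewrite mulr1.
have -> : source v = \int[mu]_(x in Om) (f x * v x * (cst 1 : T -> R) x).
  by apply: eq_Rintegral => x _; rewrite mulr1.
apply: le_trans h _.
have f0 : 0 <= \int[mu]_(x in Om) (f x ^+ 2 * 1).
  by apply: Rintegral_ge0 => x _; rewrite mulr1 sqr_ge0.
have vq : \int[mu]_(x in Om) (v x ^+ 2 * 1) <= q v.
  by rewrite -lee_fin EFin_Rintegral//; exact: energy_part1_le.
rewrite mulrDr mulr1 mulrDl mul1r.
by have := mulr_ge0 f0 (q0 v); rewrite /cst/=; lra.
Qed.

(** The factor 1 makes the sum a nested instance of [bilinear_on_linear]. *)
Let weak_form (u v : T -> R) := 2^-1 * kernel_form mu Om K Om u v +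
  (1 * kernel_form mu Om K W u v + alpha_form u v).

(** The energy integrates y over the whole space while the weak form sees only Om and W; by [K_out]
    the rest carries no weight. *)
Let energy_split u : V u ->
  \int[mu2]_(z in Om `*` setT) (increment u z * increment u z * Kt z) =
  \int[mu2]_(z in Om `*` Om) (increment u z ^+ 2 * Kt z) +
  \int[mu2]_(z in Om `*` W) (increment u z ^+ 2 * Kt z).
Proof.
move=> Vu; have [mu_ _ u2] := Vu.
have OU : Om `*` Om `|` Om `*` W = Om `*` (Om `|` W) by apply/seteqP; split=> z /=; tauto.
have mOU := mOS (measurableU _ _ mOm mW).
have dis : [disjoint Om `*` Om & Om `*` W].
  apply/disj_setPS => z [[_ h1] [_ h2]] /=.
  by have : (Om `&` W) z.2 by []; rewrite OmW.
rewrite -Rintegral_setU//; try exact: mOS; last first.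
  by rewrite OU; apply: integrableS u2 => //; [exact: mOS|move=> z []].
rewrite OU; congr fine.
rewrite [LHS]integral_mkcond [RHS]integral_mkcond.
apply: ae_eq_integral => //.
- apply/(measurable_restrictT _ (mOS measurableT)).
  exact: (minc2 mKt mu_).
- apply/(measurable_restrictT _ mOU); exact: minc2.
apply: filterS K_out => z h _; rewrite !patchE !in_setX in_setT andbT in_setU.
case: (boolP (z.1 \in Om)) => //= /set_mem Oz.
case: (boolP (z.2 \in Om)) => //= /negP nO; case: (boolP (z.2 \in W)) => //= /negP nW.
rewrite h ?mulr0// => [/mem_set|/mem_set]//.
Qed.

(** The 1/2 is what is left of the increment energy, through the prefactor on Om x Om and through
    Young's inequality on Om x W. All terms in u(x)^2 are collected over Om, where the bound on
    alpha leaves at least c. *)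
Let coercive u : V u -> Num.min 2^-1 c * q u <= weak_form u u.
Proof.
move=> Vu; have [mu_ u1 u2] := Vu.
rewrite /weak_form mul1r.
rewrite (kernel_form_diag_sym mOm mK K0 mOm M0 gapOm gap_energyOm Vu erefl).
have := kernel_form_diag_ge mOm mK K0 mW M0 gapW gap_energyW Vu C10 agap_le.
have [_ iP ->] := fst_sq_fubini mOm mK K0 mOm M0 gapOm Vu mgap (fun z => lexx _).
have agap_norm z : `|agap z| <= agap z by rewrite /agap normr_id.
have [_ iN ->] := fst_sq_fubini mOm mK K0 mW M0 gapW Vu magap agap_norm.
set N := \int[mu]_(x in Om) (u x ^+ 2 * _).
set P := \int[mu]_(x in Om) (u x ^+ 2 * _).
rewrite /energy_dot energy_split//.
set QO := \int[mu2]_(z in Om `*` Om) _; set QW := \int[mu2]_(z in Om `*` W) _.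
set U := \int[mu]_(x in Om) (u x * u x * 1).
have QO0 : 0 <= QO by apply: Rintegral_ge0 => z _; rewrite -lee_fin; exact: inc20.
have QW0 : 0 <= QW by apply: Rintegral_ge0 => z _; rewrite mulr_ge0 ?sqr_ge0//; exact: K0.
have U0 : 0 <= U by have [] := energy_parts_ge0 mu Om Kt0 u.
have [iA _] := alpha_form_estimate Vu Vu.
(* As one integral over Om, this has integrand u^2 (alpha + a/2 - (C + 1)/2 b - c), nonnegative by
   [alpha_lb]. The nesting of g1, g2, g3 follows the shape of [Rintegral_linear]. *)
have key : 0 <= 2^-1 * P + (- ((C + 1) / 2) * N + (- c * U + alpha_form u u)).
  pose a x := fine (\int[mu]_(y in Om) (gap (x, y))%:E).
  pose b x := fine (\int[mu]_(y in W) (agap (x, y))%:E).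
  pose g3 x := - c * (u x * u x * 1) + u x * u x * alpha x.
  pose g2 x := - ((C + 1) / 2) * (u x ^+ 2 * b x) + g3 x.
  pose g1 x := 2^-1 * (u x ^+ 2 * a x) + g2 x.
  have j3 : mu.-integrable Om (EFin \o g3).
    by apply: eq_integrable (integrableD mOm (integrableZl mOm (- c) u1) iA).
  have j2 : mu.-integrable Om (EFin \o g2).
    by apply: eq_integrable (integrableD mOm (integrableZl mOm (- ((C + 1) / 2)) iN) j3).
  have j1 : mu.-integrable Om (EFin \o g1).
    by apply: eq_integrable (integrableD mOm (integrableZl mOm (2^-1) iP) j2).
  suff : 0 <= \int[mu]_(x in Om) g1 x.
    by rewrite Rintegral_linear// [X in _ + X]Rintegral_linear//
      [X in _ + (_ + X)]Rintegral_linear.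
  apply: ae_Rintegral_ge0 => //; rewrite /g1 /g2 /g3 /a /b.
  apply: filterS3 gapOm gapW alpha_lb => x h1 h2 h3 Ox.
  have {}h1 := h1 Ox; have {}h2 := h2 Ox; have {h3} := h3 Ox.
  have fW : (\int[mu]_(y in W) (agap (x, y))%:E)%E \is a fin_num.
    rewrite ge0_fin_numE; first exact: le_lt_trans h2 (ltry _).
    by apply: integral_ge0 => y _; rewrite lee_fin.
  have fO : (\int[mu]_(y in Om) (gap (x, y))%:E)%E \is a fin_num.
    rewrite fin_num_abs; apply: le_lt_trans (ltry M).
    apply: le_trans h1; apply: le_trans (le_abse_integral _ _ _) _ => //.
    by apply/measurable_EFinP/measurable_funTS; exact: measurable_fun_pair2.
  rewrite -(fineK fW) -(fineK fO) -!EFinM -EFinN -!EFinD lte_fin.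
  set a1 := fine _; set b1 := fine _; move=> h.
  have -> : 2^-1 * (u x ^+ 2 * a1) + (- ((C + 1) / 2) * (u x ^+ 2 * b1) +
    (- c * (u x * u x * 1) + u x * u x * alpha x)) =
    u x ^+ 2 * (alpha x + 2^-1 * a1 - (C + 1) / 2 * b1 - c) by ring.
  by rewrite mulr_ge0 ?sqr_ge0// subr_ge0 ltW.
move=> hW.
have mq : Num.min 2^-1 c * (U + (QO + QW)) <= c * U + 2^-1 * (QO + QW).
  by rewrite mulrDr lerD// ler_wpM2r ?addr_ge0// ge_min lexx ?orbT.
lra.
Qed.

Theorem nonlocal_weak_solution : exists2 u, V u & forall v, V v ->
  (2^-1%:E * \int[mu]_(x in Om) \int[mu]_(y in Om)
      ((u x * K (x, y) - u y * K (y, x)) * (v x - v y))%:E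
   + \int[mu]_(x in Om) \int[mu]_(y in W)
      ((u x * K (x, y) - u y * K (y, x)) * (v x - v y))%:E
   + \int[mu]_(x in Om) (u x * v x * alpha x)%:E
   = \int[mu]_(x in Om) (f x * v x)%:E)%E.
Proof.
have bOm := kernel_form_bound mOm mK K0 mOm M0 gapOm (ler0n R 2) gap_energyOm.
have bW := kernel_form_bound mOm mK K0 mW M0 gapW (ltW C10) gap_energyW.
have iOm := kernel_form_integrable mOm mK K0 mOm M0 gapOm gap_energyOm.
have iW := kernel_form_integrable mOm mK K0 mW M0 gapW gap_energyW.
have V0 : V 0 by exact: energy_space0.
have VS : forall a u v, V u -> V v -> V (a *: u + v).
  exact: (energy_space_linear mOm mKt Kt0).
have dL : bilinear_on V (energy_dot mu Om Kt).
  exact: (energy_dot_bilinear mu mOm mKt Kt0).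
have dC u v : V u -> V v -> energy_dot mu Om Kt u v = energy_dot mu Om Kt v u.
  by move=> _ _; exact: energy_dotC.
have comp := @energy_space_complete _ T R mu Om Kt mOm mKt Kt0.
set F0 := \int[mu]_(x in Om) (f x ^+ 2 * 1).
have F00 : 0 <= F0 by apply: Rintegral_ge0 => x _; rewrite mulr1 sqr_ge0.
(* The summands bound the form on Om (C' = 2), the form on W (C' = C + 1) and the alpha term. Adding
   the bound 1 + F0 of the source gives one constant for both the form and the functional. *)
pose k0 := 2^-1 * (1 + M + 2) + ((1 + M + (C + 1)) + M).
pose k := k0 + (1 + F0).
have a0 : 0 < Num.min 2^-1 c by rewrite lt_min invr_gt0 ltr0n c0.
have mOO := mOS mOm; have mOW := mOS mW.
have BL : bilinear_on V weak_form.
  apply: bilinear_on_linear.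
    exact: (kernel_form_bilinear mOm mK K0 mOm M0 gapOm gap_energyOm).
  apply: bilinear_on_linear.
    exact: (kernel_form_bilinear mOm mK K0 mW M0 gapW gap_energyW).
  apply: bilinear_on_Rintegral => //.
  - by move=> u v Vu Vv; have [] := alpha_form_estimate Vu Vv.
  - by move=> k' u v w x; rewrite !fctE /GRing.scale/=; ring.
  - by move=> k' u v w x; rewrite !fctE /GRing.scale/=; ring.
have BK : bounded_form V (energy_dot mu Om Kt) k weak_form.
  move=> u v Vu Vv; rewrite /weak_form mul1r.
  have h1 := bOm _ _ Vu Vv; have h2 := bW _ _ Vu Vv.
  have [_ h3] := alpha_form_estimate Vu Vv.
  apply: le_trans (ler_normD _ _) _; rewrite normrM gtr0_norm ?invr_gt0//.
  apply: (@le_trans _ _ (2^-1 * ((1 + M + 2) * (q u + q v)) +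
    ((1 + M + (C + 1)) * (q u + q v) + M * (q u + q v)))); last first.
    by have := mulr_ge0 F00 (addr_ge0 (q0 u) (q0 v)); have := q0 u; have := q0 v;
      rewrite /k /k0; lra.
  apply: lerD; first by rewrite ler_pM2l ?invr_gt0.
  by apply: le_trans (ler_normD _ _) _; exact: lerD.
have FL : linear_on V source.
  move=> a u v Vu Vv; have [i1 _] := source_estimate Vu; have [i2 _] := source_estimate Vv.
  rewrite /source -Rintegral_linear//; apply: eq_Rintegral => x _.
  by rewrite !fctE /GRing.scale/=; ring.
have FK : bounded_functional V (energy_dot mu Om Kt) k source.
  move=> v Vv; have [_ h] := source_estimate Vv; apply: le_trans h _.
  rewrite -/F0; apply: ler_wpM2r; first by rewrite addr_ge0.
  by rewrite /k lerDr /k0; have := M0; have := C10; lra.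
have [u Vu uP] := lax_milgram V0 VS dL dC (fun u _ => q0 u) comp a0 BL BK coercive FL FK.
exists u => // v Vv.
have [iA _] := alpha_form_estimate Vu Vv; have [iF _] := source_estimate Vv.
rewrite -[RHS]EFin_Rintegral// -/(source v) -uP//.
have E1 := etrans (EFin_Rintegral mOO (iOm _ _ Vu Vv)) (fubini_setX1 mOm mOm (iOm _ _ Vu Vv)).
have E2 := etrans (EFin_Rintegral mOW (iW _ _ Vu Vv)) (fubini_setX1 mOm mW (iW _ _ Vu Vv)).
have E3 := EFin_Rintegral mOm iA.
rewrite /weak_form mul1r EFinD EFinM [in RHS]EFinD addeA.
by rewrite -/(kernel_form mu Om K Om u v) in E1; rewrite E1 E2 E3.
Qed.

End WeakSolution.

(** * Completed product measures *)

Section Completion.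
Context d (T : measurableType d) (R : realType).
Variable m : {measure set T -> \bar R}.
Local Open Scope ereal_scope.

(** The hull is the intersection of covers whose measures exceed the outer measure by at most 1/(n +
    1). *)
Lemma mu_ext_hull (A : set T) : mu_ext m A < +oo ->
  exists B, [/\ measurable B, A `<=` B & m B <= mu_ext m A].
Proof.
move=> Aoo.
have Afin : mu_ext m A \is a fin_num by rewrite ge0_fin_numE ?mu_ext_ge0.
have ex n : exists B, [/\ measurable B, A `<=` B & m B <= mu_ext m A + n.+1%:R^-1%:E].
  have n0 : (0 < n.+1%:R^-1 :> R)%R by rewrite invr_gt0.
  have [_ [F [mF AF] <-] /ltW lt] := lb_ereal_inf_adherent n0 Afin.
  exists (\bigcup_k F k); split => //; first exact: bigcupT_measurable.
  apply: le_trans lt; apply: measure_sigma_subadditive => //.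
  exact: bigcupT_measurable.
have /choice[B BP] := ex.
exists (\bigcap_n B n); split.
- by apply: bigcapT_measurable => n; have [] := BP n.
- by move=> x Ax n _; have [_ + _] := BP n; exact.
apply/lee_addgt0Pr => e e0.
have [n ne] : exists n, (n.+1%:R^-1 <= e)%R.
  exists (Num.truncn e^-1); rewrite -[leRHS]invrK lef_pV2 ?posrE ?invr_gt0//.
  by rewrite ltW// truncnS_gt.
apply: (@le_trans _ _ (m (B n))).
  have [mB _ _] := BP n; apply: le_measure; rewrite ?inE//.
  - by apply: bigcapT_measurable => k; have [] := BP k.
  - exact: bigcap_inf.
have [_ _ h] := BP n; apply: le_trans h _.
by rewrite leeD2l// lee_fin.
Qed.

Lemma mu_ext_negligible (A : set T) : mu_ext m A = 0 -> m.-negligible A.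
Proof.
move=> A0; have [|B [mB AB]] := @mu_ext_hull A; first by rewrite A0.
by rewrite A0 measure_le0 => /eqP B0; exists B.
Qed.

Lemma ae_completed (P : T -> Prop) :
  {ae @completed_measure_extension _ _ _ m, forall x, P x} -> {ae m, forall x, P x}.
Proof.
move=> [N [_ N0 PN]]; have [B [mB B0 NB]] := mu_ext_negligible N0.
by exists B; split => //; exact: subset_trans NB.
Qed.

Hypothesis sfm : sigma_finite [set: T] m.

(** Sigma-finiteness cuts A into pieces of finite outer measure. The Caratheodory criterion for a
    piece, tested on its hull, shows by cancelling a finite term that the hull exceeds the piece by
    a null set. *)
Lemma caratheodory_mod_negligible (A : set T) : caratheodory_measurable (mu_ext m) A ->
  exists B, [/\ measurable B, A `<=` B & m.-negligible (B `\` A)].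
Proof.
move=> cA; have [F TF mF] := sfm.
have mE B : measurable B -> mu_ext m B = m B by exact: measurable_mu_extE.
have ex k : exists B, [/\ measurable B, A `&` F k `<=` B &
    m.-negligible (B `\` (A `&` F k))].
  have [mFk Fkoo] := mF k.
  have lt : mu_ext m (A `&` F k) < +oo.
    apply: le_lt_trans Fkoo; apply: (@le_trans _ _ (mu_ext m (F k))).
      by apply: le_mu_ext; exact: subIsetr.
    by rewrite le_eqVlt; apply/orP; left; apply/eqP; exact: mE.
  have [B [mB AB mBA]] := mu_ext_hull lt; exists B; split => //.
  apply: mu_ext_negligible.
  have cAk : caratheodory_measurable (mu_ext m) (A `&` F k).
    apply: caratheodory_measurable_setI => //.
    exact: caratheodory_measurable_mu_ext.
  have := cAk B; rewrite (setIidr AB) => BE.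
  have fin : mu_ext m (A `&` F k) \is a fin_num by rewrite ge0_fin_numE ?mu_ext_ge0.
  have h : mu_ext m B <= mu_ext m (A `&` F k).
    apply: le_trans mBA; rewrite le_eqVlt; apply/orP; left; apply/eqP; exact: mE.
  rewrite [leLHS]BE in h.
  apply/eqP; rewrite eq_le; apply/andP; split; last exact: mu_ext_ge0.
  by rewrite setDE -(leeD2lE _ _ fin) adde0; exact: h.
have /choice[B BP] := ex.
exists (\bigcup_k B k); split.
- by apply: bigcupT_measurable => k; have [] := BP k.
- move=> x Ax; have : setT x by []. 
  rewrite TF => -[k _ Fx]; exists k => //.
  by have [_ + _] := BP k; apply; split.
- apply: (@negligibleS _ _ _ _ (\bigcup_k (B k `\` (A `&` F k)))).
    by move=> x [[k _ Bx] nAx]; exists k => //; split => // -[].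
  by apply: negligible_bigcup => k; have [] := BP k.
Qed.

(** Each set {f > p}, p rational, has a measurable hull with null excess; N is the union of these
    countably many excesses. Off N, {f > x} is the union of the hulls over rational p > x. *)
Lemma caratheodory_measurable_fun (f : T -> R) :
  measurable_fun [set: caratheodory_type (mu_ext m)] f ->
  exists N, [/\ measurable N, m N = 0 & measurable_fun (~` N) f].
Proof.
move=> mf.
have ex (p : rat) : exists BN : set T * set T,
    [/\ measurable BN.1, [set x | ratr p < f x]%R `<=` BN.1, measurable BN.2,
     m BN.2 = 0 & BN.1 `\` [set x | ratr p < f x]%R `<=` BN.2].
  have cA : caratheodory_measurable (mu_ext m) [set x | ratr p < f x]%R.
    have := mf measurableT `]ratr p, +oo[%classic (measurable_itv _).
    by rewrite setTI preimage_itvoy.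
  have [B [mB AB [N [mN N0 BN]]]] := caratheodory_mod_negligible cA.
  by exists (B, N).
have /choice[BN BNP] := ex.
pose NN := \bigcup_p (BN p).2.
have mNN : measurable NN.
  by apply: bigcupT_measurable_rat => p; have [] := BNP p.
exists NN; split => //.
  apply: measure_negligible => //.
  pose G n := if unpickle n is Some p then (BN p).2 else set0.
  apply: (@negligibleS _ _ _ _ (\bigcup_n G n)).
    move=> x [p _ px]; exists (pickle p); first exact: Logic.I.
    by rewrite /G pickleK; exact: px.
  apply: negligible_bigcup => n; rewrite /G; case: unpickle => [p|].
    by have [_ _ mN N0 _] := BNP p; exists (BN p).2; split.
  exact: negligible_set0.
apply: (measurability _ (RGenOInfty.measurableE R)) => // _ [_ [x ->] <-].
rewrite (_ : _ `&` _ = \bigcup_(p in [set: rat])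
    (if (x < ratr p)%R then ~` NN `&` (BN p).1 else set0)).
  apply: bigcupT_measurable_rat => p; case: ifP => // _.
  by apply: measurableI; [exact: measurableC|have [] := BNP p].
apply/seteqP; split => [y []|y [p _]].
  rewrite preimage_itvoy => nN /= xf.
  have [p] := rat_in_itvoo xf; rewrite in_itv/= => /andP[xp pf].
  exists p => //; rewrite xp; split => //.
  by have [_ h _ _ _] := BNP p; exact: h.
case: ifP => // xp [nN By]; split => //.
rewrite preimage_itvoy/= (lt_trans xp)// ltNge; apply/negP => fp.
apply: nN; exists p => //; have [_ _ _ _ h] := BNP p; apply: h; split => //=.
by apply/negP; rewrite -leNgt.
Qed.

End Completion.

Section ProductCompletion.
Context d (T : measurableType d) (R : realType).
Variable mu : {sigma_finite_measure set T -> \bar R}.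
Local Open Scope ereal_scope.

(* The library's canonical sigma-finite structure on [mu \x mu] is shadowed by
   the one for probability measures, so [sigma_finiteT] does not apply. *)
Lemma product_sigma_finite : sigma_finite [set: T * T] (mu \x mu).
Proof.
have /sigma_finiteP[F [TF ndF Foo]] := sigma_finiteT mu.
exists (fun n => F n `*` F n); last first.
  move=> k; have [mF kF] := Foo k; split; first exact: measurableX.
  have -> : (mu \x mu) (F k `*` F k) = mu (F k) * mu (F k) by exact: product_measure1E.
  by rewrite lte_mul_pinfty// ge0_fin_numE.
rewrite -setXTT TF; apply/seteqP; split => [[x y] [/= [n _ Fx] [k _ Fy]]|].
  exists (maxn n k) => //; split => /=.
  - by move: x Fx; exact/subsetPset/ndF/leq_maxl.
  - by move: y Fy; exact/subsetPset/ndF/leq_maxr.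
by move=> [x y] [n _ [/= ? ?]]; split; exists n.
Qed.
Lemma product_caratheodory_measurable_fun (f : T * T -> R) : 
  measurable_fun [set: caratheodory_type (mu_ext (mu \x mu))] f ->
  exists N, [/\ measurable N, (mu \x mu) N = 0 & measurable_fun (~` N) f].
Proof.
exact: (@caratheodory_measurable_fun _ _ R (mu \x mu) product_sigma_finite).
Qed.

Lemma ae_product_completed (P : T * T -> Prop) :
  {ae @completed_measure_extension _ _ _ (mu \x mu), forall x, P x} ->
  {ae mu \x mu, forall x, P x}.
Proof.
exact: (@ae_completed _ _ _ (mu \x mu)).
Qed.
End ProductCompletion.

(** * Product null sets and iterated integrals modulo null sets *)

Section ProductNullSets.
Context d (T : measurableType d) (R : realType).
Variable mu : {sigma_finite_measure set T -> \bar R}.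
Local Open Scope ereal_scope.

(** Both orders of integration define the same product measure, by its uniqueness on rectangles. *)
Lemma ae_swap (P : T * T -> Prop) : {ae mu \x mu, forall z, P z} ->
  {ae mu \x mu, forall z, P (z.2, z.1)}.
Proof.
move=> [N [mN N0 PN]]; exists ((fun z => (z.2, z.1)) @^-1` N); split.
- rewrite -[X in measurable X]setTI; exact: measurable_swap.
- transitivity ((mu \x^ mu) N).
    rewrite /= /product_measure1 /product_measure2; apply: eq_integral => x _ /=.
    by rewrite xsectionE ysectionE.
  rewrite -N0; apply/esym; apply: product_measure_unique => // A B mA mB.
  exact: product_measure2E.
- by move=> z /= nP; apply: PN.
Qed.

Lemma ae_section (P : T * T -> Prop) : {ae mu \x mu, forall z, P z} ->
  {ae mu, forall x, {ae mu, forall y, P (x, y)}}.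
Proof.
move=> [N [mN N0 PN]].
have mx := measurable_fun_xsection mu mN.
have /ae_eq_integral_abs : \int[mu]_x `|(mu \o xsection N) x| = 0.
  by rewrite -[RHS]N0; apply: eq_integral => x _; rewrite gee0_abs.
move=> /(_ measurableT mx); apply: filterS => x h.
exists (xsection N x); split.
- exact: measurable_xsection.
- exact: h.
- by move=> y /= nP; apply/xsectionP; exact: PN.
Qed.

(** [F x] is only known to agree almost everywhere with a measurable section. Completeness makes
    such sections measurable, and likewise their integral as a function of x. *)
Hypothesis cmu : measure_is_complete mu.
Variables (F : T -> T -> R) (G : T * T -> R) (S : set T).
Hypotheses (mS : measurable S) (mG : measurable_fun setT G).
Hypothesis FG : {ae mu, forall x, {ae mu, forall y, S y -> F x y = G (x, y)}}.

Lemma section_integral_ae_eq : {ae mu, forall x,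
  \int[mu]_(y in S) (F x y)%:E = \int[mu]_(y in S) (G (x, y))%:E}.
Proof.
apply: filterS FG => x h.
have mGx : measurable_fun S (fun y => (G (x, y))%:E).
  by apply/measurable_EFinP/measurable_funTS; exact: measurable_fun_pair2.
have FGx : ae_eq mu S (fun y => (F x y)%:E) (fun y => (G (x, y))%:E).
  by apply: filterS h => y + Sy => ->.
apply: ae_eq_integral => //.
exact: (ae_measurable_fun cmu (ae_eq_sym FGx)).
Qed.

Lemma section_integral_measurable (A : set T) : measurable A ->
  measurable_fun A (fun x => \int[mu]_(y in S) (F x y)%:E).
Proof.
move=> mA; apply: (@ae_measurable_fun _ _ _ _ cmu _
  (fun x => \int[mu]_(y in S) (G (x, y))%:E)).
  by apply: filterS section_integral_ae_eq => x -> _.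
by apply: (measurable_integral_setX1 mu (f := EFin \o G)) => //; exact/measurable_EFinP.
Qed.

Lemma iterated_integral_ae_eq (A : set T) : measurable A ->
  \int[mu]_(x in A) \int[mu]_(y in S) (F x y)%:E =
  \int[mu]_(x in A) \int[mu]_(y in S) (G (x, y))%:E.
Proof.
move=> mA; apply: ae_eq_integral => //.
- exact: section_integral_measurable.
- by apply: (measurable_integral_setX1 mu (f := EFin \o G)) => //; exact/measurable_EFinP.
- by apply: filterS section_integral_ae_eq => x -> _.
Qed.

End ProductNullSets.

Section NormFacts.
Context d (T : measurableType d) (R : realType).
Variable mu : {measure set T -> \bar R}.
Local Open Scope ereal_scope.

Lemma Lnorm_pinfty_bound (g : T -> \bar R) : 'N[mu]_+oo[g] < +oo ->
  exists2 M : R, (0 <= M)%R & {ae mu, forall x, `|g x| <= M%:E}.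
Proof.
rewrite unlock; case: ifPn => [_ h|]; last first.
  rewrite -leNgt measure_le0 => /eqP mu0 _.
  by exists 0%R => //; exact: measure0_ae.
exists (Num.max 0%R (fine (ess_sup mu (abse \o g)))); first by rewrite le_max lexx.
apply: filterS (ess_sup_ge mu (abse \o g)) => x /= hx.
have e0 : 0 <= ess_sup mu (abse \o g) by exact: le_trans hx.
have fin : ess_sup mu (abse \o g) \is a fin_num by rewrite ge0_fin_numE.
by apply: le_trans hx _; rewrite -{1}(fineK fin) lee_fin le_max lexx orbT.
Qed.

End NormFacts.

(** * Reduction of the completed product to a product-measurable kernel *)

Section AeKernel.
Context d (T : measurableType d) (R : realType).
Variable mu : {sigma_finite_measure set T -> \bar R}.
Hypothesis cmu : measure_is_complete mu.
Variables (Om : set T) (gamma : T -> T -> R) (f alpha : T -> R) (C c : R).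
Hypothesis mOm : measurable Om.
Hypothesis gamma_ge0 : forall x y, 0 <= gamma x y.
Local Open Scope ereal_scope.

Definition neumann_set : set T :=
  [set y | ~ Om y /\ 0 < \int[mu]_(x in Om) (gamma y x + gamma x y)%:E].

Definition nonlocal_energy_space : set (T -> R) :=
  [set v : T -> R | measurable_fun setT v /\
    \int[mu]_(x in Om) (v x ^+ 2)%:E +
    \int[mu]_(x in Om) \int[mu]_y ((v x - v y) ^+ 2 * gamma y x)%:E < +oo].

Local Notation W := neumann_set.

(* [gamma] is only measurable for the completed product, so it is replaced by a
   kernel [K] that agrees with it off a product-measurable null set. *)
Theorem nonlocal_weak_solution_completed (N : set (T * T)) :
  measurable N -> (mu \x mu) N = 0 ->
  measurable_fun (~` N) (fun z => gamma z.1 z.2) ->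
  f \_ Om \in Lfun mu 2%:E -> alpha \_ Om \in Lfun mu +oo ->
  'N[mu]_+oo[(fun x => 2^-1%:E *
    \int[mu]_(y in Om) (`|gamma x y - gamma y x|)%:E) \_ Om] < +oo ->
  'N[mu]_+oo[(fun x =>
    \int[mu]_(y in W) (`|gamma x y - gamma y x|)%:E) \_ Om] < +oo ->
  (0 < C)%R -> (0 < c)%R ->
  {ae mu \x mu, forall z, W z.1 -> Om z.2 -> (gamma z.2 z.1 <= C * gamma z.1 z.2)%R} ->
  {ae mu, forall x, Om x -> c%:E < (alpha x)%:E
    + 2^-1%:E * \int[mu]_(y in Om) (gamma x y - gamma y x)%:E
    - ((C + 1) / 2)%:E * \int[mu]_(y in W) (`|gamma x y - gamma y x|)%:E} ->
  exists2 u, nonlocal_energy_space u & forall v, nonlocal_energy_space v ->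
    2^-1%:E * \int[mu]_(x in Om) \int[mu]_(y in Om)
      ((u x * gamma x y - u y * gamma y x) * (v x - v y))%:E
    + \int[mu]_(x in Om) \int[mu]_(y in W)
      ((u x * gamma x y - u y * gamma y x) * (v x - v y))%:E
    + \int[mu]_(x in Om) (u x * v x * alpha x)%:E
    = \int[mu]_(x in Om) (f x * v x)%:E.
Proof.
move=> mN N0 mgN f_L2 alpha_Loo B1 B2 C_gt0 c_gt0 gamma_le alpha_lb.
pose K : T * T -> R := (fun z => gamma z.1 z.2) \_ (~` N).
have mK : measurable_fun setT K.
  exact/(measurable_restrictT _ (measurableC mN)).
have K0 z : (0 <= K z)%R by rewrite /K patchE; case: ifP.
have aeK : {ae mu \x mu, forall z, gamma z.1 z.2 = K z}.
  exists N; split => // z /= h; apply: contrapT => nN; apply: h.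
  by rewrite /K patchE mem_set.
have sec1 := ae_section aeK; have sec2 := ae_section (ae_swap aeK).
pose Kt (z : T * T) := K (z.2, z.1).
have mKt : measurable_fun setT Kt.
  by apply: measurableT_comp => //; exact: measurable_swap.
have Kt0 z : (0 <= Kt z)%R by exact: K0.
(* Each integrand depends on gamma only through gamma x y and gamma y x, so one statement transfers
   them all from gamma to [K]. *)
have transfer (P : T -> T -> R -> R -> R) (S : set (T)) :
    {ae mu, forall x, {ae mu, forall y, S y ->
      P x y (gamma x y) (gamma y x) = P x y (K (x, y)) (K (y, x))}}.
  apply: filterS2 sec1 sec2 => x h1 h2; apply: filterS2 h1 h2 => y /= -> ->.
  by [].
pose h (y : T) := \int[mu]_(x in Om) (gamma y x + gamma x y)%:E.
have mG : measurable_fun setT (fun z => K z + Kt z)%R by exact: measurable_funD.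
have tG := transfer (fun _ _ a b => a + b)%R Om.
(* The integral defining W agrees almost everywhere with a measurable function of y, hence is
   measurable by completeness. *)
have mW : measurable (W : set (T)).
  have mh := section_integral_measurable cmu mOm mG tG measurableT.
  have -> : W = ~` Om `&` (setT `&` [set y | 0 < h y]).
    by rewrite setTI; apply/seteqP; split.
  apply: measurableI; first exact: measurableC.
  exact: emeasurable_fun_o_infty.
have OmW : Om `&` W = set0.
  by apply/seteqP; split => // y [Oy [nOy _]].
have sq_measurable (v : T -> R) : measurable_fun setT v ->
    measurable_fun setT (fun z => (v z.1 - v z.2) ^+ 2 * Kt z)%R.
  move=> mv; apply: measurable_funM => //; apply: measurable_funX.
  by apply: measurable_funB; exact: measurableT_comp.
have energyE (v : T -> R) : measurable_fun setT v -> \int[mu]_(x in Om) (v x ^+ 2)%:E +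
    \int[mu]_(x in Om) \int[mu]_y ((v x - v y) ^+ 2 * gamma y x)%:E =
    \int[mu]_(x in Om) (v x ^+ 2 * 1)%:E +
    \int[mu \x mu]_(z in Om `*` setT) (increment v z ^+ 2 * Kt z)%:E.
  move=> mv; congr (_ + _).
    by apply: eq_integral => x _; rewrite mulr1.
  rewrite (iterated_integral_ae_eq cmu measurableT (sq_measurable _ mv)
    (transfer (fun x y _ b => (v x - v y) ^+ 2 * b)%R setT) mOm).
  have mE : measurable_fun setT (fun z => (increment v z ^+ 2 * Kt z)%:E).
    by apply/measurable_EFinP; exact: (sq_measurable v mv).
  have E0 z : 0 <= (increment v z ^+ 2 * Kt z)%:E.
    by rewrite lee_fin mulr_ge0 ?sqr_ge0 ?Kt0.
  by rewrite (@tonelli_setX1 _ _ _ mu _ _ _ mOm measurableT mE E0).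
have VP (v : T -> R) : nonlocal_energy_space v <-> energy_space mu Om Kt v.
  have p1 : 0 <= \int[mu]_(x in Om) (v x ^+ 2 * 1)%:E.
    by apply: integral_ge0 => x _; rewrite lee_fin mulr1 sqr_ge0.
  have p2 : 0 <= \int[mu \x mu]_(z in Om `*` setT) (increment v z ^+ 2 * Kt z)%:E.
    by apply: integral_ge0 => z _; rewrite lee_fin mulr_ge0 ?sqr_ge0 ?Kt0.
  split => [[mv]|[mv v1 v2]].
    rewrite energyE// => lt; apply: energy_spaceP => //.
    - by apply: le_lt_trans lt; rewrite leeDl.
    - by apply: le_lt_trans lt; rewrite leeDr.
  split => //; rewrite energyE//; apply: lte_add_pinfty.
    exact: (integrable_lty mOm v1).
  exact: (integrable_lty (measurableX mOm measurableT) v2).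
have [M1 M10 M1P] := Lnorm_pinfty_bound B1.
have [M2 M20 M2P] := Lnorm_pinfty_bound B2.
have /andP[/[!inE]/= mal /Lnorm_pinfty_bound[M3 M30 M3P]] := alpha_Loo.
(* One constant above all three bounds; the 2 undoes the factor 1/2 in the hypothesis on Om. *)
pose M := (2 * M1 + M2 + M3)%R.
have M0 : (0 <= M)%R by rewrite !addr_ge0// mulr_ge0.
have mgap : measurable_fun setT (fun z => K z - Kt z)%R by exact: measurable_funB.
have magap : measurable_fun setT (fun z => `|K z - Kt z|)%R by exact: measurableT_comp.
have tgap S := transfer (fun _ _ a b => a - b)%R S.
have tagap S := transfer (fun _ _ a b => `|a - b|)%R S.
have gapOm := section_integral_ae_eq cmu mOm mgap (tgap Om).
have agapOm := section_integral_ae_eq cmu mOm magap (tagap Om).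
have agapW := section_integral_ae_eq cmu mW magap (tagap W).
have [||||||||u Vu uP] := @nonlocal_weak_solution _ _ R mu Om W K (alpha \_ Om) (f \_ Om)
  M C c mOm mW OmW mK K0 mal _ M0 C_gt0 c_gt0.
- by have /andP[/[!inE]] := f_L2.
- apply: filterS2 M1P agapOm => x; rewrite patchE => h1 h2 Ox; rewrite -h2.
  move: h1; rewrite mem_set// gee0_abs; last first.
    by rewrite mule_ge0// integral_ge0// => y _; rewrite lee_fin.
  move=> h1; apply: (@le_trans _ _ (2 * M1)%:E); last first.
    by rewrite lee_fin /M; lra.
  rewrite EFinM -[leLHS]mul1e -[1](_ : 2%:E * 2^-1%:E = 1); last first.
    by rewrite -EFinM divff.
  by rewrite -muleA lee_wpmul2l// lee_fin.
- apply: filterS2 M2P agapW => x; rewrite patchE => h1 h2 Ox; rewrite -h2.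
  move: h1; rewrite mem_set// gee0_abs; last first.
    by rewrite integral_ge0// => y _; rewrite lee_fin.
  by move=> /le_trans; apply; rewrite lee_fin /M; lra.
- have := ae_swap gamma_le.
  apply: filterS3 aeK (ae_swap aeK) => z h1 h2 h3 Oz Wz.
  by move: (h3 Wz Oz); rewrite /= h1 h2.
(* For y outside Om and W, the integral of K(y,x) + K(x,y) over x in Om is not positive, hence 0,
   for almost every such y. By Tonelli Kt then has integral 0 over Om x S0 and so vanishes almost
   everywhere there. *)
- pose S0 := ~` (Om `|` W).
  have mS0 : measurable S0 by apply: measurableC; exact: measurableU.
  have mKtE : measurable_fun setT (EFin \o Kt) by exact/measurable_EFinP.
  have Kt0E z : 0 <= (EFin \o Kt) z by rewrite lee_fin.
  have int0 : \int[mu \x mu]_(z in Om `*` S0) `|(Kt z)%:E| = 0.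
    rewrite (eq_integral (EFin \o Kt)); last by move=> z _; rewrite gee0_abs ?lee_fin.
    rewrite tonelli_setX2//.
    rewrite -[RHS](@integral0 _ _ _ mu S0); apply: ae_eq_integral => //.
      exact: measurable_tonelli2.
    apply: filterS (section_integral_ae_eq cmu mOm mG tG) => y hy Sy.
    have h0 : h y = 0.
      apply/eqP; rewrite eq_le; apply/andP; split.
        rewrite leNgt; apply/negP => hpos; apply: Sy.
        by have [Oy|nOy] := pselect (Om y); [left|right].
      by apply: integral_ge0 => x _; rewrite lee_fin addr_ge0.
    apply/eqP; rewrite eq_le; apply/andP; split; last first.
      by apply: integral_ge0 => x _; exact: Kt0E.
    rewrite -h0 /h hy; apply: ge0_le_integral => //.
    - by apply/measurable_EFinP/measurable_funTS; exact: (measurable_fun_pair2 y mK).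
    - by apply/measurable_EFinP/measurable_funTS; exact: (measurable_fun_pair2 y mG).
    - by move=> x _; rewrite lee_fin lerDl.
  have mOS0 : measurable (Om `*` S0) by exact: measurableX.
  have := (ae_eq_integral_abs (mu \x mu) mOS0 (measurable_funTS mKtE)).1 int0.
  apply: filterS => z hz Oz nOz nWz.
  by apply: EFin_inj; apply: hz; split => // -[].
- apply: filterS M3P => x h1 Ox; move: h1; rewrite lee_fin /= => h1.
  by apply: le_trans h1 _; rewrite /M; lra.
- have := Lfun2_integrable_sqr f_L2.
  move=> /(integrableS measurableT mOm (@subsetT _ _)).
  by apply: eq_integrable => // x _; rewrite /= mulr1.
- apply: filterS3 alpha_lb gapOm agapW => x h1 h2 h3 Ox.
  by rewrite -h2 -h3 patchE mem_set//; exact: h1.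
exists u; first exact/VP.
move=> v /VP Vv; have := uP v Vv.
have mF : measurable_fun setT (fun z =>
    (u z.1 * K z - u z.2 * Kt z) * (v z.1 - v z.2))%R.
  have [mu_ _ _] := Vu; have [mv _ _] := Vv.
  apply: measurable_funM; apply: measurable_funB; try apply: measurable_funM => //;
    exact: measurableT_comp.
have tF S := transfer (fun x y a b => (u x * a - u y * b) * (v x - v y))%R S.
have -> := iterated_integral_ae_eq cmu mOm mF (tF Om) mOm.
have -> := iterated_integral_ae_eq cmu mW mF (tF W) mOm.
have -> : \int[mu]_(x in Om) (u x * v x * (alpha \_ Om) x)%:E =
    \int[mu]_(x in Om) (u x * v x * alpha x)%:E.
  by apply: eq_integral => x Ox; rewrite patchE Ox.
have -> : \int[mu]_(x in Om) ((f \_ Om) x * v x)%:E =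
    \int[mu]_(x in Om) (f x * v x)%:E.
  by apply: eq_integral => x Ox; rewrite patchE Ox.
exact.
Qed.

End AeKernel.

(** * Lebesgue measure *)

Section LebesgueRd.
Context (R : realType) (d : nat).

Lemma leb_complete : measure_is_complete (leb : set (Rd R d) -> \bar R).
Proof. exact: (@measure_is_complete_caratheodory R _ (@leb_outer R d)). Qed.

Lemma box_set_measurable (p : 'rV[R]_d * 'rV[R]_d) :
  measurable (box_set p : set (Rd R d)).
Proof.
have -> : box_set p = \bigcap_(i : 'I_d) ([set x | x ord0 i <= p.2 ord0 i]%R `\`
    [set x | x ord0 i <= p.1 ord0 i]%R).
  apply/seteqP; split => [x xp i _|x xp i].
    have /andP[ax xb] := xp i; split => //=.
    by apply/negP; rewrite -ltNge.
  have [/= xb /negP ax] := xp i Logic.I; rewrite xb andbT.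
  by rewrite ltNge.
apply: fin_bigcap_measurable => // i _.
by apply: measurableD; exact: halfspace_measurable.
Qed.

(** A is the union of the countably many boxes with rational corners inside it: corners within e of
    x in every coordinate keep the box in the sup-norm ball of radius e. *)
Lemma open_measurable_Rd (A : set 'rV[R]_d) : open A -> measurable (A : set (Rd R d)).
Proof.
move=> oA.
pose b (p : 'rV[rat]_d * 'rV[rat]_d) : set 'rV[R]_d :=
  box_set (map_mx ratr p.1, map_mx ratr p.2).
pose G n : set 'rV[R]_d :=
  if unpickle n is Some p then if `[< b p `<=` A >] then b p else set0 else set0.
have -> : A = \bigcup_n G n.
  apply/seteqP; split => [x Ax|x [n _]]; last first.
    rewrite /G; case: unpickle => [p|//].
    by case: asboolP => // bA; exact: bA.
  have /nbhs_ballP[e /= e0 eA] : nbhs x A by exact: open_nbhs_nbhs.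
  have exp i : exists p : rat, x ord0 i - e < ratr p < x ord0 i.
    have [|p] := @rat_in_itvoo R (x ord0 i - e) (x ord0 i); first by rewrite ltrBlDr ltrDl.
    by rewrite in_itv/=; exists p.
  have exq i : exists p : rat, x ord0 i < ratr p < x ord0 i + e.
    have [|p] := @rat_in_itvoo R (x ord0 i) (x ord0 i + e); first by rewrite ltrDl.
    by rewrite in_itv/=; exists p.
  have [p pP] := choice exp; have [q qP] := choice exq.
  pose r := (\row_i p i, \row_i q i) : 'rV[rat]_d * 'rV[rat]_d.
  exists (pickle r); first exact: Logic.I.
  rewrite /G pickleK; case: asboolP => [_ i|]; last first.
    case; move=> y yb; apply: eA; split => // i j; rewrite ord1.
    have := yb j; rewrite !mxE => /andP[y1 y2].
    have /andP[p1 p2] := pP j; have /andP[q1 q2] := qP j.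
    by rewrite /ball/= ltr_distl; apply/andP; split; lra.
  rewrite !mxE; have /andP[_ ->] := pP i.
  by have /andP[/ltW -> _] := qP i.
apply: bigcupT_measurable => n; rewrite /G; case: unpickle => [p|//].
by case: asboolP => // _; exact: box_set_measurable.
Qed.

End LebesgueRd.

Local Open Scope ereal_scope.

Theorem theorem3p11 (R : realType) (d : nat) (Omega : set 'rV[R]_d)
    (f alpha : 'rV[R]_d -> R) (gamma : 'rV[R]_d -> 'rV[R]_d -> R)
    (bounded_Omega : bounded_set Omega)
    (nonempty_Omega : Omega !=set0)
    (open_Omega : open Omega)
    (f_L2 : Lp_on Omega 2%:E f)
    (alpha_Loo : Lp_on Omega +oo alpha)
    (gamma_ge0 : forall x y, (0 <= gamma x y)%R)
    (gamma_meas : measurable_fun [set: Rd2 R d] (fun z => gamma z.1 z.2))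
    (gamma_bound :
      Linfty_norm_on Omega (fun x => 2^-1%:E *
        \int[leb]_(y in Omega) (`|gamma x y - gamma y x|)%:E) +
      Linfty_norm_on Omega (fun x =>
        \int[leb]_(y in hatGamma_set Omega gamma) (`|gamma x y - gamma y x|)%:E)
      < +oo)
    (C c : R) (C_gt0 : (0 < C)%R) (c_gt0 : (0 < c)%R)
    (gamma_le : {ae leb2, forall z : Rd2 R d,
      hatGamma_set Omega gamma z.1 -> Omega z.2 ->
      (gamma z.2 z.1 <= C * gamma z.1 z.2)%R})
    (alpha_lb : {ae leb, forall x : Rd R d, Omega x ->
      c%:E < (alpha x)%:E
        + 2^-1%:E * \int[leb]_(y in Omega) (gamma x y - gamma y x)%:E
        - ((C + 1) / 2)%:E * \int[leb]_(y in hatGamma_set Omega gamma)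
            (`|gamma x y - gamma y x|)%:E}) :
  exists2 u : 'rV[R]_d -> R, V_space Omega gamma u &
    forall v : 'rV[R]_d -> R, V_space Omega gamma v ->
      2^-1%:E * \int[leb]_(x in Omega) \int[leb]_(y in Omega)
        ((u x * gamma x y - u y * gamma y x) * (v x - v y))%:E
      + \int[leb]_(x in Omega) \int[leb]_(y in hatGamma_set Omega gamma)
        ((u x * gamma x y - u y * gamma y x) * (v x - v y))%:E
      + \int[leb]_(x in Omega) (u x * v x * alpha x)%:E
      = \int[leb]_(x in Omega) (f x * v x)%:E.
Proof.
have mOm : measurable (Omega : set (Rd R d)) by exact: open_measurable_Rd.
pose mu : {sigma_finite_measure set (Rd R d) -> \bar R} := leb.
have [N [mN N0 mgN]] := @product_caratheodory_measurable_fun _ _ R mu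
  (fun z => gamma z.1 z.2) gamma_meas.
have [B1 B2] : Linfty_norm_on Omega (fun x => 2^-1%:E *
      \int[leb]_(y in Omega) (`|gamma x y - gamma y x|)%:E) < +oo /\
    Linfty_norm_on Omega (fun x =>
      \int[leb]_(y in hatGamma_set Omega gamma) (`|gamma x y - gamma y x|)%:E) < +oo.
  by split; apply: le_lt_trans gamma_bound; rewrite ?leeDl ?leeDr// Lnorm_ge0.
(* With [mu] the Lebesgue measure, [neumann_set] and [nonlocal_energy_space] unfold to
   [hatGamma_set] and [V_space]. *)
exact: (@nonlocal_weak_solution_completed _ _ R mu (@leb_complete R d) Omega gamma f
  alpha C c mOm gamma_ge0 N mN N0 mgN f_L2 alpha_Loo B1 B2 C_gt0 c_gt0
  (ae_product_completed gamma_le) alpha_lb).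
Qed.
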